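(* Let $H$ be a Hopf algebra with invertible antipode over a field $k$ of characteristic $0$. The category of stable anti-Yetter-Drinfeld modules over $H$ is equivalent to the category of representable symmetric $2$-contratraces on the monoidal category $\mathcal{M}^H$ of right $H$-comodules, via $$M\longleftrightarrow \mathrm{Hom}(-,M)^H.$$
   Context: Sweedler notation: $\Delta(h)=h^1\otimes h^2$; a right coaction is $m\mapsto m_0\otimes m_1$. $S$ is the antipode. $\mathcal{M}^H$ is monoidal with coaction $m_0\otimes n_0\otimes m_1n_1$ on $M\otimes N$ and unit the trivial comodule $k$; $\mathrm{Hom}(-,-)^H$ denotes comodule maps. Anti-Yetter-Drinfeld module: a left $H$-module and right $H$-comodule $M$ with $(hm)_0\otimes(hm)_1=h^2m_0\otimes h^3m_1S(h^1)$ for all $h\in H$, $m\in M$; morphisms are $H$-linear and $H$-colinear maps. It is stable if $m_1m_0=m$ for all $m\in M$. Symmetric $2$-contratrace on a ($k$-linear) monoidal category $\mathcal{C}$ with unit $1$: a $k$-linear contravariant functor $\mathcal{F}:\mathcal{C}\to\mathrm{Vec}$ together with isomorphisms $\iota_{W,V}:\mathcal{F}(W\otimes V)\to\mathcal{F}(V\otimes W)$, natural in $W,V$, such that (suppressing associativity and unit constraints) $\iota_{W,U\otimes V}=\iota_{V\otimes W,U}\circ\iota_{W\otimes U,V}$, $\iota_{W,1}=Id_{\mathcal{F}(W)}$, and (symmetry) $\iota_{1,W}=Id_{\mathcal{F}(W)}$. Morphisms are natural transformations commuting with the $\iota$'s. It is representable if the underlying functor is representable. For a stable anti-Yetter-Drinfeld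 module $M$ the functor $\mathcal{F}=\mathrm{Hom}(-,M)^H$ is equipped with $\iota_{W,V}(f)(v\otimes w)=v_1f(w\otimes v_0)$. *)

(* Defs.v *)
From HB Require Import structures.
From mathcomp Require Import all_boot all_algebra.
From mathcomp Require Import boolp functions.
Set Implicit Arguments.
Unset Strict Implicit.
Unset Printing Implicit Defensive.
Import GRing.Theory.
Local Open Scope ring_scope.
Local Open Scope quotient_scope.

Section Tensor.
Variables (k : fieldType) (V W : lmodType k).

(* V (x) W is the quotient of the finite formal sums of pure tensors, encoded *)
(* as sequences of pairs, by the congruence generated by bilinearity; scalars *)
(* act on the left factor.                                                    *)
Inductive tens_rel : seq (V * W) -> seq (V * W) -> Prop :=
| tens_refl s : tens_rel s s
| tens_sym s t : tens_rel s t -> tens_rel t s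
| tens_trans s t r : tens_rel s t -> tens_rel t r -> tens_rel s r
| tens_cat s s' t t' : tens_rel s s' -> tens_rel t t' ->
    tens_rel (s ++ t) (s' ++ t')
| tens_catC s t : tens_rel (s ++ t) (t ++ s)
| tens_zero w : tens_rel [:: (0, w)] [::]
| tens_addl u v w : tens_rel [:: (u + v, w)] [:: (u, w); (v, w)]
| tens_addr u w x : tens_rel [:: (u, w + x)] [:: (u, w); (u, x)]
| tens_scale a u w : tens_rel [:: (a *: u, w)] [:: (u, a *: w)].

Definition tens_relb (s t : seq (V * W)) : bool := `[< tens_rel s t >].

Lemma tens_relb_refl : reflexive tens_relb.
Proof. by move=> s; apply/asboolP; apply: tens_refl. Qed.

Lemma tens_relb_sym : symmetric tens_relb.
Proof. by move=> s t; apply/asboolP/asboolP; apply: tens_sym. Qed.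

Lemma tens_relb_trans : transitive tens_relb.
Proof.
by move=> s t r /asboolP st /asboolP tr; apply/asboolP; apply: tens_trans tr.
Qed.

Canonical tens_equiv :=
  EquivRel tens_relb tens_relb_refl tens_relb_sym tens_relb_trans.

Definition tens : Type := {eq_quot tens_equiv}.
HB.instance Definition _ := Choice.on tens.

Definition tcls (s : seq (V * W)) : tens := \pi_({eq_quot tens_equiv}) s.
Definition trep (t : tens) : seq (V * W) := repr (t : {eq_quot tens_equiv}).

Lemma trepK t : tcls (trep t) = t. Proof. exact: reprK. Qed.

Lemma tclsP s t : tcls s = tcls t <-> tens_rel s t.
Proof.
split=> [/eqmodP/asboolP //|h]; by apply/eqmodP; apply/asboolP.
Qed.

Lemma trep_rel s : tens_rel (trep (tcls s)) s.
Proof. by apply/tclsP; rewrite trepK. Qed.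

Definition tscl (a : k) : seq (V * W) -> seq (V * W) :=
  map (fun p => (a *: p.1, p.2)).

Lemma tscl_rel a s t : tens_rel s t -> tens_rel (tscl a s) (tscl a t).
Proof.
elim=> {s t} /=.
- by move=> s; apply: tens_refl.
- by move=> s t _; apply: tens_sym.
- by move=> s t r _ st _; apply: tens_trans st.
- by move=> s s' t t' _ h _ h'; rewrite /tscl !map_cat; apply: tens_cat.
- by move=> s t; rewrite /tscl !map_cat; apply: tens_catC.
- by move=> w; rewrite scaler0; apply: tens_zero.
- by move=> u v w; rewrite scalerDr; apply: tens_addl.
- by move=> u w x; apply: tens_addr.
- move=> b u w; rewrite scalerA mulrC -scalerA; exact: tens_scale.
Qed.

Definition tadd (s t : tens) : tens := tcls (trep s ++ trep t).
Definition tzero : tens := tcls [::].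
Definition tscale (a : k) (t : tens) : tens := tcls (tscl a (trep t)).
Definition topp (t : tens) : tens := tscale (-1) t.

Lemma taddE s t : tadd (tcls s) (tcls t) = tcls (s ++ t).
Proof. by apply/tclsP; apply: tens_cat; apply: trep_rel. Qed.

Lemma tscaleE a s : tscale a (tcls s) = tcls (tscl a s).
Proof. by apply/tclsP; apply: tscl_rel; apply: trep_rel. Qed.

Lemma taddA : associative tadd.
Proof.
by move=> x y z; rewrite -(trepK x) -(trepK y) -(trepK z) !taddE catA.
Qed.

Lemma taddC : commutative tadd.
Proof.
by move=> x y; rewrite -(trepK x) -(trepK y) !taddE; apply/tclsP/tens_catC.
Qed.

Lemma tadd0 : left_id tzero tadd.
Proof. by move=> x; rewrite -(trepK x) taddE. Qed.

Lemma tscaleDl_subproof x a b :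
  tscale (a + b) x = tadd (tscale a x) (tscale b x).
Proof.
rewrite -(trepK x); elim: (trep x) => [|[u w] s IHs].
  by rewrite !tscaleE taddE.
have cE c : tcls (tscl c ((u, w) :: s)) =
    tadd (tcls [:: (c *: u, w)]) (tscale c (tcls s)).
  by rewrite tscaleE taddE.
rewrite !tscaleE !cE IHs scalerDl.
have -> : tcls [:: (a *: u + b *: u, w)] =
    tadd (tcls [:: (a *: u, w)]) (tcls [:: (b *: u, w)]).
  by rewrite taddE; apply/tclsP; apply: tens_addl.
rewrite -!taddA; congr tadd; rewrite !taddA; congr tadd; exact: taddC.
Qed.

Lemma tscaleDr : right_distributive tscale tadd.
Proof.
move=> a x y; rewrite -(trepK x) -(trepK y) taddE !tscaleE taddE.
by rewrite /tscl map_cat.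
Qed.

Lemma tscale1 : left_id 1 tscale.
Proof.
move=> x; rewrite -(trepK x) tscaleE /tscl; congr tcls.
by rewrite -[RHS]map_id; apply: eq_map => -[u w] /=; rewrite scale1r.
Qed.

Lemma tscale0 x : tscale 0 x = tzero.
Proof.
rewrite -(trepK x) tscaleE; apply/tclsP.
elim: (trep x) => [|[u w] s IHs] /=; first exact: tens_refl.
rewrite scale0r -cat1s -[[::]]cat0s; apply: tens_cat => //; exact: tens_zero.
Qed.

Lemma taddN : left_inverse tzero topp tadd.
Proof.
move=> x; rewrite -{2}(tscale1 x) /topp -tscaleDl_subproof addNr.
exact: tscale0.
Qed.

HB.instance Definition _ :=
  GRing.isZmodule.Build tens taddA taddC tadd0 taddN.

Lemma tscaleA a b x : tscale a (tscale b x) = tscale (a * b) x.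
Proof.
rewrite -(trepK x) !tscaleE /tscl -map_comp; congr tcls.
by apply: eq_map => -[u w] /=; rewrite scalerA.
Qed.

Lemma tscaleDl x : {morph tscale^~ x : a b / a + b}.
Proof. by move=> a b; apply: tscaleDl_subproof. Qed.

HB.instance Definition _ :=
  GRing.Zmodule_isLmodule.Build k tens tscaleA tscale1 tscaleDr tscaleDl.

Definition ptens (u : V) (w : W) : tens := tcls [:: (u, w)].


Definition bilin (U : lmodType k) (f : V -> W -> U) : Prop :=
  (forall w, linear (f^~ w)) /\ (forall u, linear (f u)).

(* Sweedler-style sum: f evaluated on one chosen decomposition of t. For      *)
(* bilinear f it is the linear map induced by f (tsumE, tsum_linear), and it  *)
(* is only ever used with such f.                                             *)
Definition tsum (U : lmodType k) (f : V -> W -> U) (t : tens) : U :=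
  \sum_(p <- trep t) f p.1 p.2.

End Tensor.

Arguments bilin {k V W U}.
Arguments tsum {k V W U}.
Notation "u *t w" := (ptens u w) (at level 38, left associativity).
Notation "'\tsum_' ( x , y <- t ) e" := (tsum (fun x y => e) t)
  (at level 41, x name, y name, t at level 100, e at level 41,
   format "'[' '\tsum_' ( x ,  y  <-  t ) '/  '  e ']'").

Section Linear.
Variables (k : fieldType).
Implicit Types U V W X : lmodType k.

Definition mklin U V (f : U -> V) (lf : linear f) : {linear U -> V} :=
  HB.pack f (GRing.isLinear.Build k U V *:%R f lf).

Lemma linear_add U V (f : U -> V) : linear f -> {morph f : x y / x + y}.
Proof. by move=> lf; apply: (raddfD (mklin lf)). Qed.
Lemma linear_scale U V (f : U -> V) a : linear f -> {morph f : x / a *: x}.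
Proof. by move=> lf; apply: (linearZ_LR (mklin lf)). Qed.
Lemma linear_0 U V (f : U -> V) : linear f -> f 0 = 0.
Proof. by move=> lf; apply: (raddf0 (mklin lf)). Qed.
Lemma linear_bigsum U V (f : U -> V) I (r : seq I) (F : I -> U) :
  linear f -> f (\sum_(i <- r) F i) = \sum_(i <- r) f (F i).
Proof. by move=> lf; apply: (raddf_sum (mklin lf)). Qed.

Lemma tsum_rel V W U (f : V -> W -> U) s t : bilin f -> tens_rel s t ->
  \sum_(p <- s) f p.1 p.2 = \sum_(p <- t) f p.1 p.2.
Proof.
move=> [fl fr]; elim=> {s t} //=.
- by move=> s t r _ -> _ ->.
- by move=> s s' t t' _ e _ e'; rewrite !big_cat /= e e'.
- by move=> s t; rewrite !big_cat /= addrC.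
- by move=> w; rewrite big_seq1 big_nil /=; apply: (linear_0 (fl w)).
- move=> u v w; rewrite big_seq1 big_cons big_seq1 /=.
  exact: (linear_add (fl w)).
- move=> u w x; rewrite big_seq1 big_cons big_seq1 /=.
  exact: (linear_add (fr u)).
- move=> a u w; rewrite !big_seq1 /= (linear_scale a (fr u)).
  exact: (linear_scale a (fl w)).
Qed.

Lemma tsum_cls V W U (f : V -> W -> U) s : bilin f ->
  tsum f (tcls s) = \sum_(p <- s) f p.1 p.2.
Proof. by move=> bf; apply: (tsum_rel bf); apply: trep_rel. Qed.

Lemma tsumE V W U (f : V -> W -> U) u w : bilin f -> tsum f (u *t w) = f u w.
Proof. by move=> bf; rewrite tsum_cls // big_seq1. Qed.

Lemma tsum_linear V W U (f : V -> W -> U) : bilin f -> linear (tsum f).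
Proof.
move=> bf a x y; rewrite -(trepK x) -(trepK y).
have -> : a *: tcls (trep x) + tcls (trep y) =
    tcls (tscl a (trep x) ++ trep y).
  by rewrite -taddE -tscaleE.
rewrite !tsum_cls // big_cat /=; congr (_ + _).
rewrite /tscl big_map scaler_sumr; apply: eq_bigr => p _ /=.
exact: (linear_scale a (bf.1 p.2)).
Qed.

Lemma bilin_ptens V W : bilin (@ptens k V W).
Proof.
split=> [w a u v | u a w x].
  rewrite /ptens; apply: etrans (_ : tcls _ = tcls (_ :: [:: _])) _.
    exact/tclsP/tens_addl.
  rewrite -cat1s -taddE; congr (_ + _).
  by change [:: (a *: u, w)] with (tscl a [:: (u, w)]); rewrite -tscaleE.
rewrite /ptens; apply: etrans (_ : tcls _ = tcls (_ :: [:: _])) _.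
  exact/tclsP/tens_addr.
rewrite -cat1s -taddE; congr (_ + _).
rewrite [RHS]/GRing.scale /= tscaleE; apply/tclsP/tens_sym/tens_scale.
Qed.

Lemma tsum_ptens V W (t : tens V W) : tsum (fun u w => u *t w) t = t.
Proof.
rewrite /tsum -[RHS]trepK; elim: (trep t) => [|[u w] s IHs].
  by rewrite big_nil.
by rewrite big_cons IHs; apply: (taddE [:: (u, w)] s).
Qed.

Lemma tens_ext V W U (f g : tens V W -> U) : linear f -> linear g ->
  (forall u w, f (u *t w) = g (u *t w)) -> f =1 g.
Proof.
move=> lf lg fg t; rewrite -(tsum_ptens t) /tsum !linear_bigsum //.
by apply: eq_bigr.
Qed.

Lemma tsum_comp V W U X (g : U -> X) (f : V -> W -> U) t : linear g ->
  g (tsum f t) = \tsum_(u, w <- t) g (f u w).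
Proof. by move=> lg; rewrite /tsum linear_bigsum. Qed.

Lemma eq_tsum V W U (f g : V -> W -> U) t : (forall u w, f u w = g u w) ->
  tsum f t = tsum g t.
Proof. by move=> fg; apply: eq_bigr. Qed.

Lemma exchange_tsum V W V' W' U (f : V -> W -> V' -> W' -> U) t t' :
  \tsum_(u, w <- t) \tsum_(u', w' <- t') f u w u' w' =
  \tsum_(u', w' <- t') \tsum_(u, w <- t) f u w u' w'.
Proof. exact: exchange_big. Qed.

Lemma lin_tsum_fun V W U X (F : X -> V -> W -> U) t :
  (forall u w, linear (fun x => F x u w)) -> linear (fun x => tsum (F x) t).
Proof.
move=> lF a x y; rewrite /tsum scaler_sumr -big_split /=.
by apply: eq_bigr => p _; apply: lF.
Qed.

Lemma lin_tsum V W U X (F : V -> W -> U) (g : X -> tens V W) :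
  bilin F -> linear g -> linear (fun x => tsum F (g x)).
Proof. by move=> bF lg a x y; rewrite lg tsum_linear. Qed.

Lemma lin_id U : linear (fun x : U => x). Proof. by []. Qed.

Lemma lin_app U V X (L : {linear V -> U}) (f : X -> V) :
  linear f -> linear (fun x => L (f x)).
Proof. by move=> lf a x y; rewrite lf linearP. Qed.

Lemma lin_ptl V W X (f : X -> V) (w : W) :
  linear f -> linear (fun x => f x *t w).
Proof. by move=> lf a x y; rewrite lf; apply: (bilin_ptens V W).1. Qed.

Lemma lin_ptr V W X (f : X -> W) (v : V) :
  linear f -> linear (fun x => v *t f x).
Proof. by move=> lf a x y; rewrite lf; apply: (bilin_ptens V W).2. Qed.

Lemma lin_mull (H : algType k) X (f : X -> H) (c : H) :
  linear f -> linear (fun x => f x * c).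
Proof. by move=> lf a x y; rewrite lf mulrDl scalerAl. Qed.

Lemma lin_mulr (H : algType k) X (f : X -> H) (c : H) :
  linear f -> linear (fun x => c * f x).
Proof. by move=> lf a x y; rewrite lf mulrDr scalerAr. Qed.

Lemma lin_scaler V X (f : X -> V) (c : k) :
  linear f -> linear (fun x => c *: f x).
Proof. by move=> lf a x y; rewrite lf scalerDr !scalerA mulrC. Qed.

Lemma lin_scalel V X (f : X -> k^o) (v : V) :
  linear f -> linear (fun x => (f x : k) *: v).
Proof. by move=> lf a x y; rewrite lf scalerDl -scalerA. Qed.

Lemma lin_scalar V X U (L : {scalar U}) (f : X -> U) (v : V) :
  linear f -> linear (fun x => L (f x) *: v).
Proof.
by move=> lf a x y; rewrite lf linearP scalerDl -scalerA.
Qed.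

Lemma lin_add V X (f g : X -> V) :
  linear f -> linear g -> linear (fun x => f x + g x).
Proof. by move=> lf lg a x y; rewrite lf lg scalerDr addrACA. Qed.

Lemma lin_bl U V W X (B : U -> V -> W) (f : X -> U) v : bilin B ->
  linear f -> linear (fun x => B (f x) v).
Proof. by move=> [bB _] lf a x y; rewrite lf; apply: bB. Qed.

Lemma lin_br U V W X (B : U -> V -> W) (f : X -> V) u : bilin B ->
  linear f -> linear (fun x => B u (f x)).
Proof. by move=> [_ bB] lf a x y; rewrite lf; apply: bB. Qed.

Lemma lin_fn U V X (L : V -> U) (f : X -> V) : linear L ->
  linear f -> linear (fun x => L (f x)).
Proof. by move=> lL lf a x y; rewrite lf; apply: lL. Qed.

End Linear.

Create HintDb lindb discriminated.

(* linp proves (bi)linearity of expressions by structural recursion. *)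
Ltac lin_fun f :=
  lazymatch f with
  | (fun x => x) => exact: lin_id
  | (fun x => @tsum _ _ _ _ (@?F x) (@?g x)) =>
      lazymatch g with
      | (fun _ => ?t) => apply (@lin_tsum_fun _ _ _ _ _ F t); linp
      | _ => lazymatch F with
             | (fun _ => ?F') => apply (@lin_tsum _ _ _ _ _ F' g); linp
             end
      end
  | (fun x => @ptens _ _ _ (@?g x) (@?h x)) =>
      lazymatch g with
      | (fun _ => ?c) => apply (@lin_ptr _ _ _ _ h c); linp
      | _ => lazymatch h with
             | (fun _ => ?c) => apply (@lin_ptl _ _ _ _ g c); linp
             end
      end
  | (fun x => (@?g x) * (@?h x)) =>
      lazymatch g with
      | (fun _ => ?c) => apply (@lin_mulr _ _ _ h c); linp
      | _ => lazymatch h with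
             | (fun _ => ?c) => apply (@lin_mull _ _ _ g c); linp
             end
      end
  | (fun x => (@?g x) *: (@?h x)) =>
      lazymatch g with
      | (fun _ => ?c) => apply (@lin_scaler _ _ _ h c); linp
      | _ => lazymatch h with
             | (fun _ => ?c) =>
                 lazymatch g with
                 | (fun y => @GRing.Linear.sort _ _ _ _ (@?L y) (@?g' y)) =>
                     lazymatch L with
                     | (fun _ => ?L') => apply (@lin_scalar _ _ _ _ L' g' c); linp
                     end
                 | _ => apply (@lin_scalel _ _ _ g c); linp
                 end
             end
      end
  | (fun x => (@?g x) + (@?h x)) => apply (@lin_add _ _ _ g h); linp
  | (fun x => @GRing.Linear.sort _ _ _ _ (@?L x) (@?g x)) =>
      lazymatch L with
      | (fun _ => ?L') => apply (@lin_app _ _ _ _ L' g); linp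
      end
  | (fun x => ?B (@?g x) (@?h x)) =>
      lazymatch g with
      | (fun _ => ?c) =>
          first [ solve [auto with lindb]
                | apply (@lin_fn _ _ _ _ (B c) h); [solve [auto with lindb] | linp]
                | apply (@lin_br _ _ _ _ _ B h c); [solve [auto with lindb] | linp]]
      | _ => lazymatch h with
             | (fun _ => ?c) => 
                apply (@lin_bl _ _ _ _ _ B g c); [solve [auto with lindb] | linp]
             end
      end
  | (fun x => ?L (@?g x)) =>
      apply (@lin_fn _ _ _ _ L g); [solve [auto with lindb] | linp]
  | _ => solve [auto with lindb]
  end
with linp :=
  intros;
  lazymatch goal with
  | |- bilin _ => split; intro; linp
  | |- @GRing.linear_for ?k ?U ?V ?s ?f =>
      let f' := eval cbv beta in f in
      lazymatch f' with
      | (fun x => _) => change (@GRing.linear_for k U V s f'); lin_fun f'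
      | _ => change (@GRing.linear_for k U V s (fun x => f' x));
             lin_fun (fun x => f' x)
      end
  end.

Record hopfAlg (k : fieldType) := HopfAlg {
  halg :> algType k;
  comul : {linear halg -> tens halg halg};
  counit : {scalar halg};
  antipode : {linear halg -> halg};
  comulA : forall h,
    \tsum_(h1, h2 <- comul h) \tsum_(a, b <- comul h1) a *t (b *t h2) =
    \tsum_(h1, h2 <- comul h) h1 *t comul h2;
  counitl : forall h, \tsum_(h1, h2 <- comul h) counit h1 *: h2 = h;
  counitr : forall h, \tsum_(h1, h2 <- comul h) counit h2 *: h1 = h;
  comul1 : comul 1 = 1 *t 1;
  comulM : forall g h, comul (g * h) =
    \tsum_(g1, g2 <- comul g) \tsum_(h1, h2 <- comul h) (g1 * h1) *t (g2 * h2);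
  counit1 : counit 1 = 1;
  counitM : forall g h, counit (g * h) = counit g * counit h;
  antipodel : forall h,
    \tsum_(h1, h2 <- comul h) (antipode h1 * h2) = counit h *: 1;
  antipoder : forall h,
    \tsum_(h1, h2 <- comul h) (h1 * antipode h2) = counit h *: 1 }.

Arguments comul {k _}.
Arguments counit {k _}.
Arguments antipode {k _}.

Record comod (k : fieldType) (H : hopfAlg k) := Comod {
  cmod :> lmodType k;
  coact : {linear cmod -> tens cmod H};
  coactA : forall m,
    \tsum_(m0, m1 <- coact m) \tsum_(a, b <- coact m0) a *t (b *t m1) =
    \tsum_(m0, m1 <- coact m) m0 *t comul m1;
  coact_counit : forall m, \tsum_(m0, m1 <- coact m) counit m1 *: m0 = m }.

Arguments coact {k H _}.

Section Comod.
Variables (k : fieldType) (H : hopfAlg k).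
Implicit Types M N P : comod H.

Definition colinear M N (f : M -> N) : Prop :=
  forall m, coact (f m) = \tsum_(m0, m1 <- coact m) f m0 *t m1.

Section Hom.
Variables M N : comod H.

Definition is_comod_morphism : {pred (M -> N)} :=
  fun f => `[< linear f /\ colinear f >].

Lemma is_comod_morphism_submod : submod_closed is_comod_morphism.
Proof.
split=> [|a f g /asboolP[lf cf] /asboolP[lg cg]]; apply/asboolP.
  split=> [b u v | m] /=; first by rewrite scaler0 addr0.
  rewrite linear0 /tsum big1 // => p _.
  exact: (linear_0 ((bilin_ptens N H).1 p.2)).
split=> [b u v | m].
  rewrite /= !fctE /= lf lg !scalerDr !scalerA [b * a]mulrC.
  by rewrite addrACA.
rewrite !fctE /= linearP cf cg /tsum scaler_sumr -big_split /=.
apply: eq_bigr => p _; symmetry; exact: (bilin_ptens N H).1.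
Qed.

HB.instance Definition _ :=
  GRing.isSubmodClosed.Build k (M -> N) is_comod_morphism
    is_comod_morphism_submod.

Record comod_hom := ComodHom {
  comod_fun :> M -> N;
  comod_funP : comod_fun \in is_comod_morphism }.

HB.instance Definition _ := [isSub for comod_fun].
HB.instance Definition _ := [Choice of comod_hom by <:].
HB.instance Definition _ := [SubChoice_isSubLmodule of comod_hom by <:].

Lemma comod_hom_linear (f : comod_hom) : linear f.
Proof. by have /asboolP[] := comod_funP f. Qed.

Lemma comod_hom_colinear (f : comod_hom) : colinear f.
Proof. by have /asboolP[] := comod_funP f. Qed.

Lemma mkchom_subproof (f : M -> N) : linear f -> colinear f ->
  f \in is_comod_morphism.
Proof. by move=> lf cf; apply/asboolP. Qed.

Definition mkchom (f : M -> N) (lf : linear f) (cf : colinear f) : comod_hom :=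
  ComodHom (mkchom_subproof lf cf).

Lemma comod_homP (f g : comod_hom) : f =1 g -> f = g.
Proof. by move=> fg; apply: val_inj; apply: funext. Qed.

Lemma comod_hom_addE (f g : comod_hom) m : (f + g) m = f m + g m.
Proof. by []. Qed.

Lemma comod_hom_scaleE a (f : comod_hom) m : (a *: f) m = a *: f m.
Proof. by []. Qed.

End Hom.
End Comod.
#[export] Hint Resolve comod_hom_linear : lindb.

Record category := Category {
  obj :> Type;
  hom : obj -> obj -> Type;
  idm : forall A, hom A A;
  cmp : forall A B C, hom B C -> hom A B -> hom A C;
  cmp1m : forall A B (f : hom A B), cmp (idm B) f = f;
  cmpm1 : forall A B (f : hom A B), cmp f (idm A) = f;
  cmpA : forall A B C D (h : hom C D) (g : hom B C) (f : hom A B),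
    cmp h (cmp g f) = cmp (cmp h g) f }.

Arguments idm {_} A.
Arguments cmp {_ A B C}.

Definition is_iso (C : category) (A B : C) (f : hom A B) : Prop :=
  exists g : hom B A, cmp g f = idm A /\ cmp f g = idm B.

Definition full_subcat (C : category) (P : C -> Prop) : category :=
  @Category {A : C | P A} (fun A B => hom (sval A) (sval B))
    (fun A => idm (sval A)) (fun A B D => @cmp C (sval A) (sval B) (sval D))
    (fun A B => @cmp1m C (sval A) (sval B))
    (fun A B => @cmpm1 C (sval A) (sval B))
    (fun A B D E => @cmpA C (sval A) (sval B) (sval D) (sval E)).

Record functor (C D : category) := Functor {
  fobj :> C -> D;
  fmor : forall A B, hom A B -> hom (fobj A) (fobj B);
  fmor1 : forall A, fmor (idm A) = idm (fobj A);
  fmorM : forall A B E (g : hom B E) (f : hom A B),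
    fmor (cmp g f) = cmp (fmor g) (fmor f) }.

Arguments fmor {C D} _ {A B}.

Definition idf (C : category) : functor C C :=
  @Functor C C (fun A => A) (fun A B f => f) (fun A => erefl)
    (fun A B E g f => erefl).

Section CompFunctor.
Variables (C D E : category) (G : functor D E) (F : functor C D).

Lemma compf1 A : fmor G (fmor F (idm A)) = idm (G (F A)).
Proof. by rewrite !fmor1. Qed.

Lemma compfM A B X (g : hom B X) (f : hom A B) :
  fmor G (fmor F (cmp g f)) = cmp (fmor G (fmor F g)) (fmor G (fmor F f)).
Proof. by rewrite !fmorM. Qed.

Definition compf : functor C E :=
  @Functor C E (fun A => G (F A)) (fun A B f => fmor G (fmor F f)) compf1 compfM.
End CompFunctor.

Definition nat_isomorphic (C D : category) (F G : functor C D) : Prop :=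
  exists eta : forall A, hom (F A) (G A),
    (forall A, is_iso (eta A)) /\
    (forall A B (f : hom A B), cmp (eta B) (fmor F f) = cmp (fmor G f) (eta A)).

Definition is_equivalence (C D : category) (F : functor C D) : Prop :=
  exists G : functor D C,
    nat_isomorphic (compf G F) (idf C) /\ nat_isomorphic (compf F G) (idf D).

Record kcat (k : fieldType) := KCat {
  kobj :> Type;
  khom : kobj -> kobj -> lmodType k;
  kid : forall A, khom A A;
  kcmp : forall A B C, khom B C -> khom A B -> khom A C;
  kcmp_bilin : forall A B C, bilin (@kcmp A B C);
  kcmp1m : forall A B (f : khom A B), kcmp (kid B) f = f;
  kcmpm1 : forall A B (f : khom A B), kcmp f (kid A) = f;
  kcmpA : forall A B C D (h : khom C D) (g : khom B C) (f : khom A B),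
    kcmp h (kcmp g f) = kcmp (kcmp h g) f }.

Arguments kid {k _} A.
Arguments kcmp {k _ A B C}.

Definition cat_of_kcat (k : fieldType) (C : kcat k) : category :=
  @Category C (@khom k C) (@kid k C) (@kcmp k C) (@kcmp1m k C) (@kcmpm1 k C)
    (@kcmpA k C).

Definition is_kiso (k : fieldType) (C : kcat k) (A B : C) (f : khom A B) : Prop :=
  @is_iso (cat_of_kcat C) A B f.

Record monoidal (k : fieldType) := Monoidal {
  mcat :> kcat k;
  mten : mcat -> mcat -> mcat;
  mtenm : forall A A' B B' : mcat,
    khom A A' -> khom B B' -> khom (mten A B) (mten A' B');
  munit : mcat;
  massoc : forall A B C : mcat, khom (mten (mten A B) C) (mten A (mten B C));
  mlunit : forall A, khom (mten munit A) A;
  mrunit : forall A, khom (mten A munit) A;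
  mtenm_bilin : forall A A' B B', bilin (@mtenm A A' B B');
  mtenm1 : forall A B, mtenm (kid A) (kid B) = kid (mten A B);
  mtenmM : forall (A A' A'' B B' B'' : mcat)
      (f' : khom A' A'') (f : khom A A') (g' : khom B' B'') (g : khom B B'),
    mtenm (kcmp f' f) (kcmp g' g) = kcmp (mtenm f' g') (mtenm f g);
  massoc_iso : forall A B C, is_kiso (massoc A B C);
  massoc_nat : forall A A' B B' C C'
      (f : khom A A') (g : khom B B') (h : khom C C'),
    kcmp (massoc A' B' C') (mtenm (mtenm f g) h) =
    kcmp (mtenm f (mtenm g h)) (massoc A B C);
  mlunit_iso : forall A, is_kiso (mlunit A);
  mlunit_nat : forall A A' (f : khom A A'),
    kcmp (mlunit A') (mtenm (kid munit) f) = kcmp f (mlunit A);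
  mrunit_iso : forall A, is_kiso (mrunit A);
  mrunit_nat : forall A A' (f : khom A A'),
    kcmp (mrunit A') (mtenm f (kid munit)) = kcmp f (mrunit A);
  mpentagon : forall A B C D,
    kcmp (massoc A B (mten C D)) (massoc (mten A B) C D) =
    kcmp (mtenm (kid A) (massoc B C D))
      (kcmp (massoc A (mten B C) D) (mtenm (massoc A B C) (kid D)));
  mtriangle : forall A B,
    kcmp (mtenm (kid A) (mlunit B)) (massoc A munit B) =
    mtenm (mrunit A) (kid B) }.

Arguments mten {k m}.
Arguments mtenm {k m A A' B B'}.
Arguments munit {k m}.
Arguments massoc {k m}.
Arguments mlunit {k m}.
Arguments mrunit {k m}.

Record presheaf (k : fieldType) (C : kcat k) := Presheaf {
  pobj :> C -> lmodType k;
  pmor : forall A B, khom A B -> {linear pobj B -> pobj A};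
  pmor_linear : forall A B a (f g : khom A B) x,
    pmor (a *: f + g) x = a *: pmor f x + pmor g x;
  pmor1 : forall A x, pmor (kid A) x = x;
  pmorM : forall A B D (g : khom B D) (f : khom A B) x,
    pmor (kcmp g f) x = pmor f (pmor g x) }.

Arguments pmor {k C} _ {A B}.

Definition representable (k : fieldType) (C : kcat k) (F : presheaf C) : Prop :=
  exists (M : C) (phi : forall A, {linear khom A M -> F A}),
    (forall A, bijective (phi A)) /\
    (forall A B (f : khom A B) (g : khom B M),
      phi A (kcmp g f) = pmor F f (phi B g)).

(* The associativity and unit constraints suppressed in the usual axioms are  *)
(* inserted explicitly by applying the functor to massoc, mlunit and mrunit;  *)
(* isomorphisms of vector spaces are bijective linear maps.                   *)
Record sym_contratrace (k : fieldType) (C : monoidal k) := SymContratrace {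
  ctfun :> presheaf C;
  iota : forall W V : C, {linear ctfun (mten W V) -> ctfun (mten V W)};
  iota_bij : forall W V, bijective (iota W V);
  iota_nat : forall (W W' V V' : C) (f : khom W W') (g : khom V V') x,
    iota W V (pmor ctfun (mtenm f g) x) =
    pmor ctfun (mtenm g f) (iota W' V' x);
  iota_tensor : forall (W U V : C) x,
    iota W (mten U V) x =
    pmor ctfun (massoc U V W) (iota (mten V W) U
      (pmor ctfun (massoc V W U) (iota (mten W U) V
        (pmor ctfun (massoc W U V) x))));
  iota_unit : forall (W : C) x,
    iota W munit (pmor ctfun (mrunit W) x) = pmor ctfun (mlunit W) x;
  iota_sym : forall (W : C) x,
    iota munit W (pmor ctfun (mlunit W) x) = pmor ctfun (mrunit W) x }.

Arguments iota {k C} _ W V.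

Section ContratraceCat.
Variables (k : fieldType) (C : monoidal k).

Record ct_hom (F G : sym_contratrace C) := CtHom {
  ct_mor :> forall A : C, F A -> G A;
  ct_mor_linear : forall A, linear (@ct_mor A);
  ct_mor_nat : forall (A B : C) (f : khom A B) x,
    ct_mor (pmor F f x) = pmor G f (ct_mor x);
  ct_mor_iota : forall (W V : C) x,
    ct_mor (iota F W V x) = iota G W V (ct_mor x) }.

Arguments ct_mor {F G} _ A.

Lemma ct_homP F G (s t : ct_hom F G) : (forall A x, s A x = t A x) -> s = t.
Proof.
case: s t => [s ls ns is_] [t lt nt it] /= st.
have e : s = t by apply: functional_extensionality_dep => A; apply: funext.
by subst t; congr CtHom; apply: Prop_irrelevance.
Qed.

Definition ct_id (F : sym_contratrace C) : ct_hom F F :=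
  @CtHom F F (fun A x => x) (fun A => @lin_id k (F A)) (fun A B f x => erefl)
    (fun W V x => erefl).

Section Comp.
Variables (F G K : sym_contratrace C) (t : ct_hom G K) (s : ct_hom F G).

Lemma ct_cmp_linear A : linear (fun x => t A (s A x)).
Proof. by move=> a x y; rewrite !ct_mor_linear. Qed.

Lemma ct_cmp_nat (A B : C) (f : khom A B) x :
  t A (s A (pmor F f x)) = pmor K f (t B (s B x)).
Proof. by rewrite !ct_mor_nat. Qed.

Lemma ct_cmp_iota (W V : C) x :
  t _ (s _ (iota F W V x)) = iota K W V (t _ (s _ x)).
Proof. by rewrite !ct_mor_iota. Qed.

Definition ct_cmp : ct_hom F K := CtHom ct_cmp_linear ct_cmp_nat ct_cmp_iota.
End Comp.

Lemma ct_cmp1m F G (s : ct_hom F G) : ct_cmp (ct_id G) s = s.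
Proof. exact: ct_homP. Qed.

Lemma ct_cmpm1 F G (s : ct_hom F G) : ct_cmp s (ct_id F) = s.
Proof. exact: ct_homP. Qed.

Lemma ct_cmpA F G K L (u : ct_hom K L) (t : ct_hom G K) (s : ct_hom F G) :
  ct_cmp u (ct_cmp t s) = ct_cmp (ct_cmp u t) s.
Proof. exact: ct_homP. Qed.

Definition sym_contratrace_cat : category :=
  @Category (sym_contratrace C) ct_hom ct_id ct_cmp ct_cmp1m ct_cmpm1 ct_cmpA.

Definition rep_sym_contratrace_cat : category :=
  @full_subcat sym_contratrace_cat (fun F : sym_contratrace C => representable F).

End ContratraceCat.

Section ComodCat.
Variables (k : fieldType) (H : hopfAlg k).
Implicit Types A B C D M N P : comod H.

Lemma coact_sw M (U : lmodType k) (F : M -> H -> H -> U) m :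
  (forall x y, linear (fun m => F m x y)) ->
  (forall m y, linear (fun x => F m x y)) ->
  (forall m x, linear (F m x)) ->
  \tsum_(m0, m1 <- coact m) \tsum_(a, b <- coact m0) F a b m1 =
  \tsum_(m0, m1 <- coact m) \tsum_(a, b <- comul m1) F m0 a b.
Proof.
move=> l1 l2 l3.
have bF x : bilin (F x) by split=> ?; [apply: l2 | apply: l3].
have bG : bilin (fun x (t : tens H H) => tsum (F x) t).
  split=> [t|x]; last exact: tsum_linear.
  by apply: lin_tsum_fun => *; apply: l1.
have := congr1 (tsum (fun x (t : tens H H) => tsum (F x) t)) (coactA m).
rewrite !(tsum_comp _ _ (tsum_linear bG)) => e; apply: etrans (etrans e _); last first.
  by apply: eq_tsum => x y; rewrite tsumE.
apply: eq_tsum => x y; rewrite (tsum_comp _ _ (tsum_linear bG)).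
by apply: eq_tsum => u w; rewrite tsumE // tsumE.
Qed.

Section Cat.
Lemma chom_id_colinear M : colinear (fun m : M => m).
Proof. by move=> m; rewrite tsum_ptens. Qed.

Definition chom_id M : comod_hom M M :=
  mkchom (@lin_id k M) (@chom_id_colinear M).

Lemma chom_cmp_linear M N P (g : comod_hom N P) (f : comod_hom M N) :
  linear (fun m => g (f m)).
Proof. linp. Qed.

Lemma chom_cmp_colinear M N P (g : comod_hom N P) (f : comod_hom M N) :
  colinear (fun m => g (f m)).
Proof.
move=> m; rewrite comod_hom_colinear comod_hom_colinear tsum_comp; last linp.
by apply: eq_tsum => x y; rewrite tsumE //; linp.
Qed.

Definition chom_cmp M N P (g : comod_hom N P) (f : comod_hom M N) :
  comod_hom M P :=
  mkchom (chom_cmp_linear g f) (chom_cmp_colinear g f).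

Lemma chom_cmp_bilin M N P : bilin (@chom_cmp M N P).
Proof.
split=> [f a g g'|g a f f']; apply: comod_homP => m //=.
exact: (comod_hom_linear g).
Qed.

Lemma chom_cmp1m M N (f : comod_hom M N) : chom_cmp (chom_id N) f = f.
Proof. exact: comod_homP. Qed.

Lemma chom_cmpm1 M N (f : comod_hom M N) : chom_cmp f (chom_id M) = f.
Proof. exact: comod_homP. Qed.

Lemma chom_cmpA M N P Q (h : comod_hom P Q) (g : comod_hom N P)
    (f : comod_hom M N) :
  chom_cmp h (chom_cmp g f) = chom_cmp (chom_cmp h g) f.
Proof. exact: comod_homP. Qed.

Definition comod_kcat : kcat k :=
  @KCat k (comod H) (fun M N => comod_hom M N) chom_id chom_cmp chom_cmp_bilin
    chom_cmp1m chom_cmpm1 chom_cmpA.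
End Cat.

Section Tensor.
Variables M N : comod H.

Definition ctens_coact_fun (t : tens M N) : tens (tens M N) H :=
  \tsum_(m, n <- t) \tsum_(m0, m1 <- coact m) \tsum_(n0, n1 <- coact n)
    (m0 *t n0) *t (m1 * n1).

Lemma ctens_coact_bilin : bilin (fun (m : M) (n : N) =>
  \tsum_(m0, m1 <- coact m) \tsum_(n0, n1 <- coact n)
    (m0 *t n0) *t (m1 * n1)).
Proof. linp. Qed.

Lemma ctens_coact_linear : linear ctens_coact_fun.
Proof. exact: tsum_linear ctens_coact_bilin. Qed.

Definition ctens_coact := mklin ctens_coact_linear.

Lemma ctens_coactE m n : ctens_coact (m *t n) =
  \tsum_(m0, m1 <- coact m) \tsum_(n0, n1 <- coact n)
    (m0 *t n0) *t (m1 * n1).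
Proof. exact: tsumE ctens_coact_bilin. Qed.

Lemma ctens_coactA t :
  \tsum_(m0, m1 <- ctens_coact t) \tsum_(a, b <- ctens_coact m0)
     a *t (b *t m1) =
  \tsum_(m0, m1 <- ctens_coact t) m0 *t comul m1.
Proof.
move: t; apply: tens_ext; [linp|linp|] => m n.
rewrite ctens_coactE (tsum_comp _ _ (tsum_linear _)); last linp.
rewrite [RHS](tsum_comp _ _ (tsum_linear _)); last linp.
pose T (a : M) (c : N) (x y z w : H) := (a *t c) *t ((x * z) *t (y * w)).
transitivity (\tsum_(m0, m1 <- coact m) \tsum_(a, b <- coact m0)
   \tsum_(n0, n1 <- coact n) \tsum_(c, d <- coact n0) T a c b m1 d n1).
  apply: eq_tsum => m0 m1.
  rewrite (tsum_comp _ _ (tsum_linear _)); last linp.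
  rewrite [RHS]exchange_tsum; apply: eq_tsum => n0 n1.
  rewrite tsumE; last linp.
  rewrite ctens_coactE (tsum_comp _ _ (tsum_linear _)); last linp.
  apply: eq_tsum => a b.
  rewrite (tsum_comp _ _ (tsum_linear _)); last linp.
  by apply: eq_tsum => c d; rewrite tsumE //; linp.
rewrite (@coact_sw M _ (fun a b m1 => \tsum_(n0, n1 <- coact n)
   \tsum_(c, d <- coact n0) T a c b m1 d n1)); try by rewrite /T; linp.
apply: eq_tsum => m0 m1.
rewrite (tsum_comp _ _ (tsum_linear _)); last linp.
rewrite exchange_tsum.
transitivity (\tsum_(a, b <- comul m1)
  \tsum_(n0, n1 <- coact n) \tsum_(c, d <- comul n1) T m0 n0 a b c d).
  rewrite exchange_tsum; apply: eq_tsum => a b.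
  rewrite (@coact_sw N _ (fun c d n1 => T m0 c a b d n1)) //;
   by rewrite /T; linp.
rewrite exchange_tsum; apply: eq_tsum => n0 n1.
rewrite tsumE; last linp.
rewrite comulM tsum_comp; last linp.
by apply: eq_tsum => a b; rewrite tsum_comp //; linp.
Qed.

Lemma ctens_coact_counit t :
  \tsum_(m0, m1 <- ctens_coact t) counit m1 *: m0 = t.
Proof.
move: t; apply: tens_ext; [linp|linp|] => m n.
rewrite ctens_coactE (tsum_comp _ _ (tsum_linear _)); last linp.
rewrite -[in RHS](coact_counit m) -[in RHS](coact_counit n).
rewrite [RHS](tsum_comp (g := fun x => x *t _)); last linp.
apply: eq_tsum => m0 m1.
rewrite (tsum_comp _ _ (tsum_linear _)); last linp.
rewrite [RHS](tsum_comp (g := fun x => _ *t x)); last linp.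
apply: eq_tsum => n0 n1.
rewrite tsumE; last linp.
rewrite counitM (linear_scale _ ((bilin_ptens _ _).2 _)).
by rewrite (linear_scale _ ((bilin_ptens _ _).1 _)) scalerA mulrC.
Qed.

Definition ctens : comod H :=
  @Comod k H (tens M N) ctens_coact ctens_coactA ctens_coact_counit.

End Tensor.

Section Unit.

Lemma cunit_coact_linear : linear (fun a : k^o => a *t (1 : H)).
Proof. linp. Qed.

Definition cunit_coact := mklin cunit_coact_linear.

Lemma cunit_coactE a : cunit_coact a = a *t 1. Proof. by []. Qed.

Lemma cunit_coactA m :
  \tsum_(m0, m1 <- cunit_coact m) \tsum_(a, b <- cunit_coact m0)
     a *t (b *t m1) =
  \tsum_(m0, m1 <- cunit_coact m) m0 *t comul m1.
Proof.
rewrite cunit_coactE tsumE; last linp.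
rewrite cunit_coactE !tsumE; [|linp|linp].
by rewrite comul1.
Qed.

Lemma cunit_coact_counit m :
  \tsum_(m0, m1 <- cunit_coact m) counit m1 *: m0 = m.
Proof. by rewrite cunit_coactE tsumE ?counit1 ?scale1r //; linp. Qed.

Definition cunit : comod H :=
  @Comod k H k^o cunit_coact cunit_coactA cunit_coact_counit.
End Unit.
End ComodCat.

Section ComodMonoidal.
Variables (k : fieldType) (H : hopfAlg k).
Implicit Types A B C D M N P : comod H.

Lemma coact_ctens M N (m : M) (n : N) : coact (m *t n : ctens M N) =
  \tsum_(m0, m1 <- coact m) \tsum_(n0, n1 <- coact n)
    ((m0 *t n0 : ctens M N) *t (m1 * n1)).
Proof. exact: ctens_coactE. Qed.

Lemma coact_cunit (a : cunit H) : coact a = a *t 1.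
Proof. by []. Qed.

Lemma colinear_tens M N P (f : ctens M N -> P) : linear f ->
  (forall m n, coact (f (m *t n)) =
    \tsum_(m0, m1 <- coact m) \tsum_(n0, n1 <- coact n)
      f (m0 *t n0) *t (m1 * n1)) ->
  colinear f.
Proof.
move=> lf cf; apply: tens_ext; [linp|linp|] => m n.
rewrite cf coact_ctens (tsum_comp _ _ (tsum_linear _)); last linp.
apply: eq_tsum => m0 m1; rewrite (tsum_comp _ _ (tsum_linear _)); last linp.
by apply: eq_tsum => n0 n1; rewrite tsumE //; linp.
Qed.

Section Map.
Variables (A A' B B' : comod H) (f : comod_hom A A') (g : comod_hom B B').

Definition ctensm_fun (t : ctens A B) : ctens A' B' :=
  \tsum_(a, b <- t) f a *t g b.

Lemma ctensm_bilin : bilin (fun a b => f a *t g b).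
Proof. linp. Qed.

Lemma ctensm_funE a b : ctensm_fun (a *t b) = f a *t g b.
Proof. exact: tsumE ctensm_bilin. Qed.

Lemma ctensm_linear : linear ctensm_fun.
Proof. exact: tsum_linear ctensm_bilin. Qed.

Lemma ctensm_colinear : colinear ctensm_fun.
Proof.
apply: (colinear_tens ctensm_linear) => m n.
rewrite ctensm_funE coact_ctens (comod_hom_colinear f) (comod_hom_colinear g).
rewrite (tsum_comp _ _ (tsum_linear _)); last linp.
apply: eq_tsum => a b; rewrite tsumE; last linp.
rewrite (tsum_comp _ _ (tsum_linear _)); last linp.
apply: eq_tsum => c d; rewrite tsumE; last linp.
by rewrite ctensm_funE.
Qed.

Definition ctensm : comod_hom (ctens A B) (ctens A' B') :=
  mkchom ctensm_linear ctensm_colinear.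

Lemma ctensmE a b : ctensm (a *t b) = f a *t g b.
Proof. exact: ctensm_funE. Qed.
End Map.

Section Assoc.
Variables A B C : comod H.

Definition cassoc_fun (t : ctens (ctens A B) C) : ctens A (ctens B C) :=
  \tsum_(ab, c <- t) \tsum_(a, b <- ab) a *t (b *t c).

Lemma cassoc_linear : linear cassoc_fun.
Proof. rewrite /cassoc_fun; linp. Qed.

Lemma cassoc_funE a b c : cassoc_fun ((a *t b) *t c) = a *t (b *t c).
Proof. by rewrite /cassoc_fun !tsumE //; linp. Qed.

Local Hint Resolve cassoc_linear : lindb.

Lemma cassoc_colinear : colinear cassoc_fun.
Proof.
apply: (colinear_tens cassoc_linear) => m c; move: m.
apply: tens_ext; [linp|linp|] => a b.
rewrite cassoc_funE !coact_ctens.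
rewrite [RHS](tsum_comp _ _ (tsum_linear _)); last linp.
apply: eq_tsum => a0 a1.
rewrite (tsum_comp _ _ (tsum_linear _)); last linp.
rewrite [RHS](tsum_comp _ _ (tsum_linear _)); last linp.
apply: eq_tsum => b0 b1.
rewrite (tsum_comp _ _ (tsum_linear _)); last linp.
rewrite [RHS]tsumE; last linp.
apply: eq_tsum => c0 c1.
by rewrite cassoc_funE tsumE ?mulrA //; linp.
Qed.

Definition cassoc : comod_hom (ctens (ctens A B) C) (ctens A (ctens B C)) :=
  mkchom cassoc_linear cassoc_colinear.

Definition cassocV_fun (t : ctens A (ctens B C)) : ctens (ctens A B) C :=
  \tsum_(a, bc <- t) \tsum_(b, c <- bc) (a *t b) *t c.

Lemma cassocV_linear : linear cassocV_fun.
Proof. rewrite /cassocV_fun; linp. Qed.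

Lemma cassocV_funE a b c : cassocV_fun (a *t (b *t c)) = (a *t b) *t c.
Proof. by rewrite /cassocV_fun !tsumE //; linp. Qed.

Local Hint Resolve cassocV_linear : lindb.

Lemma cassocV_colinear : colinear cassocV_fun.
Proof.
apply: (colinear_tens cassocV_linear) => a.
apply: tens_ext; [linp|linp|] => b c.
rewrite cassocV_funE !coact_ctens.
rewrite (tsum_comp _ _ (tsum_linear _)); last linp.
apply: eq_tsum => a0 a1.
rewrite (tsum_comp _ _ (tsum_linear _)); last linp.
rewrite [RHS](tsum_comp _ _ (tsum_linear _)); last linp.
apply: eq_tsum => b0 b1.
rewrite [RHS](tsum_comp _ _ (tsum_linear _)); last linp.
rewrite [LHS]tsumE; last linp.
apply: eq_tsum => c0 c1.
by rewrite tsumE ?cassocV_funE ?mulrA //; linp.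
Qed.

Definition cassocV : comod_hom (ctens A (ctens B C)) (ctens (ctens A B) C) :=
  mkchom cassocV_linear cassocV_colinear.

Lemma cassocE a b c : cassoc ((a *t b) *t c) = a *t (b *t c).
Proof. exact: cassoc_funE. Qed.

Lemma cassocVE a b c : cassocV (a *t (b *t c)) = (a *t b) *t c.
Proof. exact: cassocV_funE. Qed.

Lemma cassoc_iso : @is_kiso k (comod_kcat H) _ _ cassoc.
Proof.
exists cassocV; split; apply: comod_homP.
  apply: tens_ext; [linp|linp|] => ab c; move: ab.
  apply: tens_ext; [linp|linp|] => a b /=.
  by rewrite cassoc_funE cassocV_funE.
apply: tens_ext; [linp|linp|] => a.
apply: tens_ext; [linp|linp|] => b c /=.
by rewrite cassocV_funE cassoc_funE.
Qed.

End Assoc.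

Section Unitors.
Variable M : comod H.

Definition clunit_fun (t : ctens (cunit H) M) : M :=
  tsum (fun (a : k^o) (m : M) => a *: m) t.

Lemma clunit_linear : linear clunit_fun.
Proof. rewrite /clunit_fun; linp. Qed.

Lemma clunit_funE a m : clunit_fun (a *t m) = (a : k) *: m.
Proof. by rewrite /clunit_fun tsumE //; linp. Qed.

Lemma clunit_colinear : colinear clunit_fun.
Proof.
apply: (colinear_tens clunit_linear) => a m.
rewrite clunit_funE coact_cunit tsumE; last first.
  by have := clunit_linear; linp.
rewrite linearZ_LR /= -[in LHS](tsum_ptens (coact m)).
rewrite (tsum_comp (g := fun x => (a : k) *: x)); last linp.
apply: eq_tsum => m0 m1.
by rewrite clunit_funE mul1r (linear_scale _ ((bilin_ptens _ _).1 _)).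
Qed.

Definition clunit : comod_hom (ctens (cunit H) M) M :=
  mkchom clunit_linear clunit_colinear.

Definition crunit_fun (t : ctens M (cunit H)) : M :=
  tsum (fun (m : M) (a : k^o) => a *: m) t.

Lemma crunit_linear : linear crunit_fun.
Proof. rewrite /crunit_fun; linp. Qed.

Lemma crunit_funE m a : crunit_fun (m *t a) = (a : k) *: m.
Proof. by rewrite /crunit_fun tsumE //; linp. Qed.

Lemma crunit_colinear : colinear crunit_fun.
Proof.
apply: (colinear_tens crunit_linear) => m a.
rewrite crunit_funE linearZ_LR /= -[in LHS](tsum_ptens (coact m)).
rewrite (tsum_comp (g := fun x => (a : k) *: x)); last linp.
apply: eq_tsum => m0 m1; rewrite tsumE; last first.
  by have := crunit_linear; linp.
by rewrite crunit_funE mulr1 (linear_scale _ ((bilin_ptens _ _).1 _)).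
Qed.

Definition crunit : comod_hom (ctens M (cunit H)) M :=
  mkchom crunit_linear crunit_colinear.

Lemma clunitE a m : clunit (a *t m) = (a : k) *: m.
Proof. exact: clunit_funE. Qed.

Lemma crunitE m a : crunit (m *t a) = (a : k) *: m.
Proof. exact: crunit_funE. Qed.

Lemma clunitV_linear : linear (fun m : M => (1 : cunit H) *t m).
Proof. linp. Qed.

Lemma clunitV_colinear :
  @colinear k H M (ctens (cunit H) M) (fun m : M => (1 : cunit H) *t m).
Proof.
move=> m; rewrite coact_ctens coact_cunit tsumE; last linp.
by apply: eq_tsum => m0 m1; rewrite mul1r.
Qed.

Lemma crunitV_linear : linear (fun m : M => m *t (1 : cunit H)).
Proof. linp. Qed.

Lemma crunitV_colinear :
  @colinear k H M (ctens M (cunit H)) (fun m : M => m *t (1 : cunit H)).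
Proof.
move=> m; rewrite coact_ctens; apply: eq_tsum => m0 m1.
by rewrite coact_cunit tsumE ?mulr1 //; linp.
Qed.

Lemma clunit_iso : @is_kiso k (comod_kcat H) _ _ clunit.
Proof.
exists (@mkchom k H M (ctens (cunit H) M) _ clunitV_linear clunitV_colinear);
  split; apply: comod_homP.
  apply: tens_ext; [linp|linp|] => a m /=; rewrite clunit_funE.
  rewrite (linear_scale _ ((bilin_ptens _ _).2 _)).
  rewrite -(linear_scale _ ((bilin_ptens _ _).1 _)).
  by congr (_ *t _); apply: mulr1.
by move=> m /=; rewrite clunit_funE scale1r.
Qed.

Lemma crunit_iso : @is_kiso k (comod_kcat H) _ _ crunit.
Proof.
exists (@mkchom k H M (ctens M (cunit H)) _ crunitV_linear crunitV_colinear);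
  split; apply: comod_homP.
  apply: tens_ext; [linp|linp|] => m a /=; rewrite crunit_funE.
  rewrite (linear_scale _ ((bilin_ptens _ _).1 _)).
  rewrite -(linear_scale _ ((bilin_ptens _ _).2 _)).
  by congr (_ *t _); apply: mulr1.
by move=> m /=; rewrite crunit_funE scale1r.
Qed.
End Unitors.

Lemma ctensm_bilin2 A A' B B' : bilin (@ctensm A A' B B').
Proof.
split=> [g a f f'|f a g g']; apply: comod_homP.
  apply: tens_ext; [linp|linp|] => x y.
  rewrite comod_hom_addE comod_hom_scaleE !ctensmE comod_hom_addE.
  exact: (bilin_ptens A' B').1.
apply: tens_ext; [linp|linp|] => x y.
rewrite comod_hom_addE comod_hom_scaleE !ctensmE comod_hom_addE.
exact: (bilin_ptens A' B').2.
Qed.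

Lemma ctensm1 A B : ctensm (chom_id A) (chom_id B) = chom_id (ctens A B).
Proof.
apply: comod_homP; apply: tens_ext; [linp|linp|] => a b.
by rewrite ctensmE.
Qed.

Lemma ctensmM A A' A'' B B' B'' (f' : comod_hom A' A'') (f : comod_hom A A')
    (g' : comod_hom B' B'') (g : comod_hom B B') :
  ctensm (chom_cmp f' f) (chom_cmp g' g) =
  chom_cmp (ctensm f' g') (ctensm f g).
Proof.
apply: comod_homP; apply: tens_ext; [linp|linp|] => a b /=.
by rewrite !ctensm_funE.
Qed.

Lemma cassoc_nat A A' B B' C C' (f : comod_hom A A') (g : comod_hom B B')
    (h : comod_hom C C') :
  chom_cmp (cassoc A' B' C') (ctensm (ctensm f g) h) =
  chom_cmp (ctensm f (ctensm g h)) (cassoc A B C).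
Proof.
apply: comod_homP; apply: tens_ext; [linp|linp|] => t c; move: t.
apply: tens_ext; [linp|linp|] => a b /=.
rewrite !(ctensm_funE, cassoc_funE) /=.
by rewrite !(ctensm_funE, cassoc_funE).
Qed.

Lemma clunit_nat A A' (f : comod_hom A A') :
  chom_cmp (clunit A') (ctensm (chom_id (cunit H)) f) = chom_cmp f (clunit A).
Proof.
apply: comod_homP; apply: tens_ext; [linp|linp|] => a m /=.
rewrite ctensm_funE !clunit_funE.
by rewrite (linear_scale _ (comod_hom_linear f)).
Qed.

Lemma crunit_nat A A' (f : comod_hom A A') :
  chom_cmp (crunit A') (ctensm f (chom_id (cunit H))) = chom_cmp f (crunit A).
Proof.
apply: comod_homP; apply: tens_ext; [linp|linp|] => a m /=.
rewrite ctensm_funE !crunit_funE.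
by rewrite (linear_scale _ (comod_hom_linear f)).
Qed.

Lemma comod_pentagon A B C D :
  chom_cmp (cassoc A B (ctens C D)) (cassoc (ctens A B) C D) =
  chom_cmp (ctensm (chom_id A) (cassoc B C D))
    (chom_cmp (cassoc A (ctens B C) D) (ctensm (cassoc A B C) (chom_id D))).
Proof.
apply: comod_homP; apply: tens_ext; [linp|linp|] => t d; move: t.
apply: tens_ext; [linp|linp|] => t c; move: t.
apply: tens_ext; [linp|linp|] => a b /=.
by do 4 rewrite ?(ctensm_funE, cassoc_funE) /=.
Qed.

Lemma comod_triangle A B :
  chom_cmp (ctensm (chom_id A) (clunit B)) (cassoc A (cunit H) B) =
  ctensm (crunit A) (chom_id B).
Proof.
apply: comod_homP; apply: tens_ext; [linp|linp|] => t b; move: t.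
apply: tens_ext; [linp|linp|] => a x /=.
rewrite !(ctensm_funE, cassoc_funE) /= clunit_funE crunit_funE.
by rewrite (linear_scale _ ((bilin_ptens _ _).2 _))
  (linear_scale _ ((bilin_ptens _ _).1 _)).
Qed.

Definition comod_monoidal : monoidal k :=
  @Monoidal k (comod_kcat H) (@ctens k H) ctensm (cunit H) cassoc clunit crunit
    ctensm_bilin2 ctensm1 ctensmM cassoc_iso cassoc_nat
    clunit_iso clunit_nat crunit_iso crunit_nat comod_pentagon comod_triangle.

End ComodMonoidal.

(* In ayd_compat, h1 (x) h2 (x) h3 is the iterated coproduct                  *)
(* (id (x) comul) (comul h).                                                  *)
Record ayd (k : fieldType) (H : hopfAlg k) := AYD {
  ayd_comod :> comod H;
  act : H -> ayd_comod -> ayd_comod;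
  act_bilin : bilin act;
  act1 : forall m, act 1 m = m;
  actM : forall g h m, act (g * h) m = act g (act h m);
  ayd_compat : forall h m, coact (act h m) =
    \tsum_(h1, h' <- comul h) \tsum_(h2, h3 <- comul h')
      \tsum_(m0, m1 <- coact m) act h2 m0 *t (h3 * m1 * antipode h1) }.

Arguments act {k H _}.
#[export] Hint Resolve act_bilin : lindb.

Definition ayd_stable (k : fieldType) (H : hopfAlg k) (M : ayd H) : Prop :=
  forall m : M, \tsum_(m0, m1 <- coact m) act m1 m0 = m.

Section AYDCat.
Variables (k : fieldType) (H : hopfAlg k).
Implicit Types M N P : ayd H.

Record ayd_hom M N := AYDHom {
  ayd_mor :> comod_hom M N;
  ayd_morP : forall (h : H) (m : M), ayd_mor (act h m) = act h (ayd_mor m) }.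

Lemma ayd_homP M N (f g : ayd_hom M N) : f =1 g -> f = g.
Proof.
case: f g => [f fP] [g gP] /= /comod_homP e; subst g; congr AYDHom.
exact: Prop_irrelevance.
Qed.

Definition ayd_id M : ayd_hom M M :=
  @AYDHom M M (chom_id M) (fun h m => erefl).

Lemma ayd_cmpP M N P (g : ayd_hom N P) (f : ayd_hom M N) (h : H) (m : M) :
  chom_cmp g f (act h m) = act h (chom_cmp g f m).
Proof. by rewrite /= !ayd_morP. Qed.

Definition ayd_cmp M N P (g : ayd_hom N P) (f : ayd_hom M N) : ayd_hom M P :=
  AYDHom (ayd_cmpP g f).

Lemma ayd_cmp1m M N (f : ayd_hom M N) : ayd_cmp (ayd_id N) f = f.
Proof. exact: ayd_homP. Qed.

Lemma ayd_cmpm1 M N (f : ayd_hom M N) : ayd_cmp f (ayd_id M) = f.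
Proof. exact: ayd_homP. Qed.

Lemma ayd_cmpA M N P Q (h : ayd_hom P Q) (g : ayd_hom N P) (f : ayd_hom M N) :
  ayd_cmp h (ayd_cmp g f) = ayd_cmp (ayd_cmp h g) f.
Proof. exact: ayd_homP. Qed.

Definition ayd_cat : category :=
  @Category (ayd H) ayd_hom ayd_id ayd_cmp ayd_cmp1m ayd_cmpm1 ayd_cmpA.

Definition sayd_cat : category :=
  @full_subcat ayd_cat (fun M : ayd H => ayd_stable M).
End AYDCat.

Section HomPresheaf.
Variables (k : fieldType) (C : kcat k) (M : C).

Lemma hom_pmor_linear (A B : C) (f : khom A B) :
  linear (fun g : khom B M => kcmp g f).
Proof. exact: (kcmp_bilin _ _ _).1. Qed.

Definition hom_presheaf : presheaf C :=
  @Presheaf k C (fun A => khom A M) (fun A B f => mklin (hom_pmor_linear f))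
    (fun A B a f g x => (kcmp_bilin A B M).2 x a f g)
    (fun A x => kcmpm1 x) (fun A B D g f x => kcmpA x g f).

Lemma hom_presheaf_representable : representable hom_presheaf.
Proof.
by exists M, (fun A => mklin (@lin_id k (khom A M))); split=> // A; exists id.
Qed.
End HomPresheaf.

Section HomContratrace.
Variables (k : fieldType) (H : hopfAlg k).

Lemma comul_sw (U : lmodType k) (F : H -> H -> H -> U) h :
  (forall x y, linear (fun z => F z x y)) ->
  (forall z y, linear (fun x => F z x y)) ->
  (forall z x, linear (F z x)) ->
  \tsum_(h1, h2 <- comul h) \tsum_(a, b <- comul h1) F a b h2 =
  \tsum_(h1, h2 <- comul h) \tsum_(a, b <- comul h2) F h1 a b.
Proof.
exact: (@coact_sw k H (@Comod k H H comul (@comulA k H) (@counitr k H))).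
Qed.

Section Iota.
Variables (M : ayd H) (W V : comod H).

(* iota (f) (v (x) w) = v_1 f (w (x) v_0) *)
Definition hom_iota_fun (f : comod_hom (ctens W V) M) (t : ctens V W) : M :=
  \tsum_(v, w <- t) \tsum_(v0, v1 <- coact v) act v1 (f (w *t v0)).

Lemma hom_iota_bilin (f : comod_hom (ctens W V) M) :
  bilin (fun v w => \tsum_(v0, v1 <- coact v) act v1 (f (w *t v0))).
Proof. linp. Qed.

Lemma hom_iota_fun_linear f : linear (hom_iota_fun f).
Proof. exact: tsum_linear (hom_iota_bilin f). Qed.

Lemma hom_iota_funE f v w : hom_iota_fun f (v *t w) =
  \tsum_(v0, v1 <- coact v) act v1 (f (w *t v0)).
Proof. exact: tsumE (hom_iota_bilin f). Qed.

Lemma hom_iota_colinear f : colinear (hom_iota_fun f).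
Proof.
apply: colinear_tens; first exact: hom_iota_fun_linear.
move=> v w; rewrite hom_iota_funE tsum_comp; last linp.
pose F (a : V) (b x y z : H) (w0 : W) (w1 : H) :=
  act y (f (w0 *t a)) *t (z * (w1 * b) * antipode x).
pose G w0 w1 a b c := \tsum_(x, h' <- comul c) \tsum_(y, z <- comul h')
  F a b x y z w0 w1.
transitivity (\tsum_(w0, w1 <- coact w) \tsum_(v0, v1 <- coact v)
    \tsum_(a, b <- coact v0) G w0 w1 a b v1).
  rewrite [RHS]exchange_tsum; apply: eq_tsum => v0 v1.
  rewrite ayd_compat comod_hom_colinear coact_ctens.
  transitivity (\tsum_(x, h' <- comul v1) \tsum_(w0, w1 <- coact w)
    \tsum_(a, b <- coact v0) \tsum_(y, z <- comul h') F a b x y z w0 w1).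
    apply: eq_tsum => x h'.
    transitivity (\tsum_(y, z <- comul h') \tsum_(w0, w1 <- coact w)
      \tsum_(a, b <- coact v0) F a b x y z w0 w1).
      apply: eq_tsum => y z.
      do 2 (rewrite (tsum_comp _ _ (tsum_linear _)); last linp).
      apply: eq_tsum => w0 w1.
      rewrite (tsum_comp _ _ (tsum_linear _)); last linp.
      apply: eq_tsum => a b.
      by do 2 (rewrite tsumE; last linp).
    rewrite exchange_tsum; apply: eq_tsum => w0 w1; exact: exchange_tsum.
  rewrite exchange_tsum; apply: eq_tsum => w0 w1; exact: exchange_tsum.
rewrite [RHS]exchange_tsum; apply: eq_tsum => w0 w1.
rewrite coact_sw; try by rewrite /G /F; linp.
transitivity (\tsum_(v0, v1 <- coact v) \tsum_(a, b <- coact v0)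
  act b (f (w0 *t a)) *t (v1 * w1)); last first.
  apply: eq_tsum => v0 v1; rewrite hom_iota_funE.
  by rewrite (tsum_comp (g := fun x => x *t _)) //; linp.
rewrite [RHS](@coact_sw _ _ V _ (fun a b c => act b (f (w0 *t a)) *t (c * w1)));
  try linp.
apply: eq_tsum => a c; rewrite /G.
rewrite -(@comul_sw _ (fun b x h' =>
  \tsum_(y, z <- comul h') F a b x y z w0 w1)); try by rewrite /F; linp.
pose K (h' : H) :=
  \tsum_(y, z <- comul h') act y (f (w0 *t a)) *t (z * w1).
transitivity (\tsum_(e, h' <- comul c) counit e *: K h').
  apply: eq_tsum => e h'.
  rewrite exchange_tsum /K tsum_comp; last linp.
  apply: eq_tsum => y z; rewrite /F.
  pose g (t : H) := act y (f (w0 *t a)) *t (z * (w1 * t)).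
  transitivity (g (\tsum_(b, x <- comul e) (b * antipode x))).
    rewrite (tsum_comp (g := g)); last by rewrite /g; linp.
    by apply: eq_tsum => b x; rewrite /g !mulrA.
  rewrite /g.
  rewrite antipoder -!scalerAr mulr1.
  by rewrite (linear_scale _ ((bilin_ptens _ _).2 _)).
have lK : linear K by rewrite /K; linp.
rewrite -/(K c) -[in RHS](counitl c) (tsum_comp _ _ lK).
by apply: eq_tsum => e h'; rewrite linear_scale.
Qed.

Definition hom_iota_raw (f : comod_hom (ctens W V) M) :
    comod_hom (ctens V W) M :=
  mkchom (hom_iota_fun_linear f) (@hom_iota_colinear f).

Lemma hom_iota_linear : linear hom_iota_raw.
Proof.
move=> a f g; apply: comod_homP; apply: tens_ext; [linp|linp|] => v w.
rewrite comod_hom_addE comod_hom_scaleE [LHS]hom_iota_funE.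
rewrite [hom_iota_raw f _]hom_iota_funE [hom_iota_raw g _]hom_iota_funE.
rewrite /tsum scaler_sumr -big_split /=; apply: eq_bigr => p _.
exact: (act_bilin M).2.
Qed.

Definition hom_iota :
  {linear comod_hom (ctens W V) M -> comod_hom (ctens V W) M} :=
  mklin hom_iota_linear.

Lemma hom_iotaE f v w : hom_iota f (v *t w) =
  \tsum_(v0, v1 <- coact v) act v1 (f (w *t v0)).
Proof. exact: hom_iota_funE. Qed.

End Iota.

Lemma hom_iotaK (M : ayd H) (W V : comod H) : ayd_stable M ->
  cancel (hom_iota M W V) (hom_iota M V W).
Proof.
move=> sM f; apply: comod_homP; apply: tens_ext; [linp|linp|] => w v.
rewrite hom_iotaE -[RHS]sM comod_hom_colinear coact_ctens.
do 2 (rewrite [RHS](tsum_comp _ _ (tsum_linear _)); last linp).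
apply: eq_tsum => w0 w1.
rewrite hom_iotaE [RHS](tsum_comp _ _ (tsum_linear _)); last linp.
rewrite tsum_comp; last linp.
apply: eq_tsum => v0 v1.
by rewrite tsumE ?tsumE ?actM //; linp.
Qed.

Lemma hom_iota_bij (M : ayd H) : ayd_stable M ->
  forall W V : comod H, bijective (hom_iota M W V).
Proof. by move=> sM W V; exists (hom_iota M V W); apply: hom_iotaK. Qed.

Lemma hom_iota_nat (M : ayd H) (W W' V V' : comod H) (f : comod_hom W W')
    (g : comod_hom V V') (x : comod_hom (ctens W' V') M) :
  hom_iota M W V (chom_cmp x (ctensm f g)) =
  chom_cmp (hom_iota M W' V' x) (ctensm g f).
Proof.
apply: comod_homP; apply: tens_ext; [linp|linp|] => v w.
rewrite hom_iotaE /= ctensm_funE hom_iota_funE comod_hom_colinear.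
rewrite [RHS](tsum_comp _ _ (tsum_linear _)); last linp.
apply: eq_tsum => v0 v1.
by rewrite ctensm_funE tsumE //; linp.
Qed.

Lemma hom_iota_tensor (M : ayd H) (W U V : comod H)
    (x : comod_hom (ctens W (ctens U V)) M) :
  hom_iota M W (ctens U V) x =
  chom_cmp (hom_iota M (ctens V W) U
    (chom_cmp (hom_iota M (ctens W U) V
      (chom_cmp x (cassoc W U V))) (cassoc V W U))) (cassoc U V W).
Proof.
apply: comod_homP; apply: tens_ext; [linp|linp|] => t w; move: t.
apply: tens_ext; [linp|linp|] => u v.
rewrite hom_iotaE coact_ctens /= cassoc_funE hom_iota_funE.
rewrite (tsum_comp _ _ (tsum_linear _)); last linp.
apply: eq_tsum => u0 u1 /=.
rewrite cassoc_funE hom_iota_funE.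
rewrite (tsum_comp _ _ (tsum_linear _)); last linp.
rewrite [RHS]tsum_comp; last linp.
apply: eq_tsum => v0 v1 /=.
by rewrite cassoc_funE tsumE ?actM //; linp.
Qed.

Lemma hom_iota_unit (M : ayd H) (W : comod H) (x : comod_hom W M) :
  hom_iota M W (cunit H) (chom_cmp x (crunit W)) = chom_cmp x (clunit W).
Proof.
apply: comod_homP; apply: tens_ext; [linp|linp|] => a w.
rewrite hom_iotaE coact_cunit tsumE; last linp.
by rewrite act1 /= clunit_funE crunit_funE.
Qed.

Lemma hom_iota_sym (M : ayd H) : ayd_stable M ->
  forall (W : comod H) (x : comod_hom W M),
  hom_iota M (cunit H) W (chom_cmp x (clunit W)) = chom_cmp x (crunit W).
Proof.
move=> sM W x; apply: comod_homP; apply: tens_ext; [linp|linp|] => w a.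
rewrite hom_iotaE /= crunit_funE (linear_scale _ (comod_hom_linear x)).
rewrite -[in RHS](sM (x w)) comod_hom_colinear.
rewrite [in RHS](tsum_comp _ _ (tsum_linear _)); last linp.
rewrite [RHS](tsum_comp (g := fun y => (a : k) *: y)); last linp.
apply: eq_tsum => w0 w1; rewrite clunit_funE tsumE; last linp.
rewrite (linear_scale _ (comod_hom_linear x)).
exact: (linear_scale _ ((act_bilin M).2 w1)).
Qed.

Definition hom_contratrace (M : ayd H) (sM : ayd_stable M) :
    sym_contratrace (comod_monoidal H) :=
  @SymContratrace k (comod_monoidal H)
    (@hom_presheaf k (comod_kcat H) (ayd_comod M)) (hom_iota M)
    (hom_iota_bij sM) (@hom_iota_nat M) (@hom_iota_tensor M)
    (@hom_iota_unit M) (hom_iota_sym sM).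

Definition hom_contratrace_obj (M : sayd_cat H) :
    rep_sym_contratrace_cat (comod_monoidal H) :=
  exist _ (hom_contratrace (svalP M))
    (@hom_presheaf_representable k (comod_kcat H) (ayd_comod (sval M))).

Section Mor.
Variables (M N : sayd_cat H) (g : ayd_hom (sval M) (sval N)).

Lemma hom_contratrace_mor_linear (A : comod H) :
  linear (fun x : comod_hom A (sval M) => chom_cmp g x).
Proof. exact: (chom_cmp_bilin _ _ _).2. Qed.

Lemma hom_contratrace_mor_nat (A B : comod H) (f : comod_hom A B)
    (x : comod_hom B (sval M)) :
  chom_cmp g (chom_cmp x f) = chom_cmp (chom_cmp g x) f.
Proof. exact: chom_cmpA. Qed.

Lemma hom_contratrace_mor_iota (W V : comod H)
    (x : comod_hom (ctens W V) (sval M)) :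
  chom_cmp g (hom_iota (sval M) W V x) = hom_iota (sval N) W V (chom_cmp g x).
Proof.
apply: comod_homP; apply: tens_ext; [linp|linp|] => v w.
rewrite /= !hom_iota_funE tsum_comp; last linp.
by apply: eq_tsum => v0 v1; rewrite ayd_morP.
Qed.

Definition hom_contratrace_mor :
    ct_hom (hom_contratrace (svalP M)) (hom_contratrace (svalP N)) :=
  @CtHom k (comod_monoidal H) (hom_contratrace (svalP M))
    (hom_contratrace (svalP N)) (fun A x => chom_cmp g x)
    hom_contratrace_mor_linear hom_contratrace_mor_nat
    hom_contratrace_mor_iota.
End Mor.

Lemma hom_contratrace_mor1 (M : sayd_cat H) :
  hom_contratrace_mor (ayd_id (sval M)) = ct_id (hom_contratrace (svalP M)).
Proof. by apply: ct_homP => A x; apply: comod_homP. Qed.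

Lemma hom_contratrace_morM (M N P : sayd_cat H)
    (g : ayd_hom (sval N) (sval P)) (f : ayd_hom (sval M) (sval N)) :
  hom_contratrace_mor (ayd_cmp g f) =
  ct_cmp (hom_contratrace_mor g) (hom_contratrace_mor f).
Proof. by apply: ct_homP => A x; apply: comod_homP. Qed.

Definition hom_contratrace_functor :
    functor (sayd_cat H) (rep_sym_contratrace_cat (comod_monoidal H)) :=
  @Functor (sayd_cat H) (rep_sym_contratrace_cat (comod_monoidal H))
    hom_contratrace_obj hom_contratrace_mor hom_contratrace_mor1
    hom_contratrace_morM.

End HomContratrace.

(* Main.v *)
From HB Require Import structures.
From mathcomp Require Import all_boot all_algebra.
From mathcomp Require Import boolp classical_sets.
Require Import Defs.

(* By Yoneda a representable contratrace is a family of natural maps iota on  *)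
(* the spaces Hom(-, M)^H. A finite-dimensional comodule V is given by a      *)
(* comultiplicative matrix T, and its dual V' by the transpose of S(T); the   *)
(* evaluation f : (M (x) V') (x) V -> M is universal among the maps           *)
(* W (x) V -> M, so naturality determines iota from the values                *)
(* iota(f)(v (x) m (x) c). These depend only on the matrix coefficient        *)
(* h = c(v_0) v_1 and on m, because every element of a comodule lies in a     *)
(* finite-dimensional subcomodule; they define h m, and                       *)
(* iota(g)(v (x) w) = v_1 g(w (x) v_0) holds for every comodule V. The axioms *)
(* of iota then become associativity, unitality and stability of this action, *)
(* and colinearity of iota(f) becomes the anti-Yetter-Drinfeld condition.     *)

Set Implicit Arguments.
Unset Strict Implicit.
Unset Printing Implicit Defensive.
Import GRing.Theory.
Local Open Scope ring_scope.

(** It is enough that the functor is fully faithful and essentially surjective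
    ([fully_faithful_eso_equivalence]). For full faithfulness, Yoneda turns a transformation into
    postcomposition with a colinear map, and compatibility with [iota], tested on the evaluations
    [fev], makes this map commute with the action ([ayd_linear_of_iota]).

    The substance is to recover an action from [iota]. A map [W (x) V -> M] with [V = fcomod T]
    factors through [fev T M] ([fev_curry]), so naturality leaves only the values [preact c v m].
    They depend on [c] and [v] through [coef c v] alone ([preact_coef]): if the coefficient is zero,
    [c] kills the subcomodule generated by [v] ([comod_local_finiteness]). Every element of [H] is a
    coefficient ([coef_regular]), hence the action [io_act], and [ioE] gives the formula for [iota]
    on all comodules. The module laws are then [io_act1] and [io_actM], the anti-Yetter-Drinfeld
    condition is [io_act_compat], and stability is [io_ayd_stable]. *)

(** * Separating functionals and minimal tensor decompositions *)

Section DualFamilies.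
Variable k : fieldType.
Implicit Types V W : lmodType k.
Local Open Scope classical_set_scope.

Definition mkscalar W (f : W -> k) (lf : scalar f) : {scalar W} :=
  HB.pack f (GRing.isLinear.Build k W k *%R f lf).

Definition subspace W (A : set W) : Prop :=
  A 0 /\ forall a x y, A x -> A y -> A (a *: x + y).

Lemma subspaceZ W (A : set W) a x : subspace A -> A x -> A (a *: x).
Proof. by move=> [A0 AP] Ax; rewrite -[_ *: _]addr0; apply: AP. Qed.

Lemma subspaceB W (A : set W) x y : subspace A -> A x -> A y -> A (x - y).
Proof.
by move=> [_ AP] Ax Ay; rewrite addrC -scaleN1r; apply: AP.
Qed.

Lemma maximal_subspace_avoiding W (U : set W) w : subspace U -> ~ U w ->
  exists A : set W, [/\ subspace A, U `<=` A, ~ A w &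
    forall B, subspace B -> A `<=` B -> ~ B w -> B `<=` A].
Proof.
move=> sU Uw.
(* Zorn's lemma is applied to sets whose union with [U] is a subspace, not to subspaces containing
   [U]: the union of the empty chain is empty and must belong to the family. *)
have [|A [[sA Aw] maxA]] :=
    @Zorn_bigcup W [set A | subspace (A `|` U) /\ ~ A w].
  move=> F FP totF; split; last by move=> [B /FP[_ Bw] /Bw].
  split; first by right; apply: sU.1.
  have up B x : F B -> (B `|` U) x -> ((\bigcup_(X in F) X) `|` U) x.
    by move=> FB [Bx|Ux]; [left; exists B | right].
  move=> a x y [[B FB Bx]|Ux] [[C FC Cy]|Uy].
  - have [BC|CB] := totF B C FB FC.
      by apply: (up C) => //; apply: (FP _ FC).1.2; left => //; apply: BC.
    by apply: (up B) => //; apply: (FP _ FB).1.2; left => //; apply: CB.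
  - by apply: (up B) => //; apply: (FP _ FB).1.2; [left|right].
  - by apply: (up C) => //; apply: (FP _ FC).1.2; [right|left].
  - by right; apply: sU.2.
exists (A `|` U); split=> [//|x Ux|[]//|]; first by right.
move=> B sB AB Bw x Bx; left.
apply: contrapT => Ax; apply: (maxA B).
  by split=> [y Ay|BA]; [apply: AB; left | apply/Ax/BA].
suff BU : B `|` U = B by split; rewrite ?BU.
by apply/setUidPl => y Uy; apply: AB; right.
Qed.

Lemma separating_functional W (U : set W) w : subspace U -> ~ U w ->
  exists f : {scalar W}, f w = 1 /\ forall u, U u -> f u = 0.
Proof.
move=> sU Uw.
have [A [sA UA Aw maxA]] := maximal_subspace_avoiding sU Uw.
(* [A] is a complement of the line of [w]: if [x] is outside [A], maximality puts [w] in the span of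
   [A] and [x]. The functional sends [x] to the unique such [c]. *)
have exc x : exists c, A (x - c *: w).
  have [Ax|Ax] := pselect (A x); first by exists 0; rewrite scale0r subr0.
  pose B := [set y | exists2 p, A p & exists c, y = p + c *: x].
  have sB : subspace B.
    split; first by exists 0; [exact: sA.1 | exists 0; rewrite scale0r addr0].
    move=> a y z [p Ap [c ->]] [q Aq [d ->]].
    exists (a *: p + q); first exact: sA.2.
    by exists (a * c + d); rewrite scalerDr scalerDl scalerA addrACA.
  have AB : A `<=` B.
    by move=> y Ay; exists y => //; exists 0; rewrite scale0r addr0.
  have [[p Ap [c wE]]|/(maxA _ sB AB) BA] := pselect (B w); last first.
    case: Ax; apply: BA; exists 0; first exact: sA.1.
    by exists 1; rewrite scale1r add0r.
  have c0 : c != 0.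
    by apply: contra_notN Aw => /eqP c0; rewrite wE c0 scale0r addr0.
  exists c^-1; rewrite wE scalerDr scalerA mulVf // scale1r opprD addrCA subrr.
  by rewrite addr0 -scalerN; apply: subspaceZ => //;
    rewrite -sub0r; apply: subspaceB => //; apply: sA.1.
have unc x c d : A (x - c *: w) -> A (x - d *: w) -> c = d.
  move=> Ac Ad; apply/eqP; rewrite -subr_eq0; apply: contra_notT Aw => cd.
  have := subspaceB sA Ad Ac; rewrite opprB addrC addrA subrK -scalerBl.
  by move=> /(subspaceZ (c - d)^-1 sA); rewrite scalerA mulVf // scale1r.
have [f fP] := choice exc.
have lf : scalar f.
  move=> a x y; apply: (unc (a *: x + y)) => //.
  have -> : a *: x + y - (a * f x + f y) *: w =
      a *: (x - f x *: w) + (y - f y *: w).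
    by rewrite scalerDl -scalerA scalerBr addrACA opprD.
  exact: sA.2.
exists (mkscalar lf); split=> [|u Uu] /=.
  by apply: (unc w) => //; rewrite scale1r subrr; apply: sA.1.
by apply: (unc u) => //; rewrite scale0r subr0; apply: UA.
Qed.

Lemma dual_family n W (b : 'I_n.+1 -> W) :
  (forall j (c : 'I_n -> k), b j <> \sum_i c i *: b (lift j i)) ->
  exists g : 'I_n.+1 -> {scalar W}, forall i j, g i (b j) = (i == j)%:R.
Proof.
move=> ind.
have gP j : exists g : {scalar W}, forall i, g (b i) = (j == i)%:R.
  pose U := [set w | exists c : 'I_n -> k, w = \sum_i c i *: b (lift j i)].
  have [|[c /(ind j)]//|g [gj gU]] := @separating_functional W U (b j).
    split; first by exists (fun=> 0); rewrite big1 // => i _; rewrite scale0r.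
    move=> a _ _ [c ->] [d ->]; exists (fun i => a * c i + d i).
    rewrite scaler_sumr -big_split; apply: eq_bigr => i _.
    by rewrite scalerDl scalerA.
  exists g => i; case: (unliftP j i) => [i' ->|->]; last by rewrite eqxx gj.
  rewrite (negPf (neq_lift _ _)); apply: gU; exists (fun l => (l == i')%:R).
  rewrite (bigD1 i') //= eqxx scale1r big1 ?addr0 // => l /negPf ->.
  by rewrite scale0r.
by have [g gE] := choice gP; exists g.
Qed.

Lemma ptensZ V W (a : k) (v : V) (w : W) : v *t (a *: w) = (a *: v) *t w.
Proof.
rewrite (linear_scale a ((bilin_ptens V W).2 v)).
by rewrite (linear_scale a ((bilin_ptens V W).1 w)).
Qed.

Lemma ptens_suml V W I r (F : I -> V) (w : W) :
  (\sum_(i <- r) F i) *t w = \sum_(i <- r) F i *t w.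
Proof. exact: (linear_bigsum r F ((bilin_ptens V W).1 w)). Qed.

Lemma ptens_sumr V W I r (F : I -> W) (v : V) :
  v *t (\sum_(i <- r) F i) = \sum_(i <- r) v *t F i.
Proof. exact: (linear_bigsum r F ((bilin_ptens V W).2 v)). Qed.

(* A decomposition with the least number of terms has both families of        *)
(* factors linearly independent.                                              *)
Lemma tens_dual_decomposition V W (t : tens V W) :
  exists n (v : 'I_n -> V) (w : 'I_n -> W),
    [/\ t = \sum_i v i *t w i,
        exists f : 'I_n -> {scalar V}, forall i j, f i (v j) = (i == j)%:R &
        exists g : 'I_n -> {scalar W}, forall i j, g i (w j) = (i == j)%:R].
Proof.
pose P n := `[< exists (v : 'I_n -> V) (w : 'I_n -> W),
  t = \sum_i v i *t w i >].
have exP : exists n, P n.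
  exists (size (trep t)); apply/asboolP.
  exists (fun i => (nth (0, 0) (trep t) i).1),
    (fun i => (nth (0, 0) (trep t) i).2).
  by rewrite -[LHS]tsum_ptens /tsum (big_nth (0, 0)) big_mkord.
case: (ex_minnP exP) => [[|n] /asboolP[v [w tE]] minn].
  by exists 0%N, v, w; split=> //; exists (fun=> \0) => -[].
exists n.+1, v, w; split=> //; apply: dual_family => j c jE.
  (* If [v j] is a combination of the other vectors, its term is distributed over theirs by
     bilinearity, which leaves [n] terms against the minimality of [n.+1]. *)
  suff /minn : P n by rewrite ltnn.
  apply/asboolP; exists (v \o lift j), (fun i => w (lift j i) + c i *: w j).
  rewrite tE (bigD1_ord j) //= jE ptens_suml -big_split /=.
  apply: eq_bigr => i _; rewrite addrC (linear_add ((bilin_ptens V W).2 _)).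
  by rewrite ptensZ.
suff /minn : P n by rewrite ltnn.
apply/asboolP; exists (fun i => v (lift j i) + c i *: v j), (w \o lift j).
rewrite tE (bigD1_ord j) //= jE ptens_sumr -big_split /=.
apply: eq_bigr => i _; rewrite addrC (linear_add ((bilin_ptens V W).1 _)).
by rewrite ptensZ.
Qed.

End DualFamilies.

(** * Linear maps on row vectors and the standard pairing *)

Section LinearExtra.
Variable k : fieldType.
Implicit Types U V W X : lmodType k.

Lemma tsum_sum V W U (F : V -> W -> U) I (r : seq I) (v : I -> V) (w : I -> W) :
  bilin F -> tsum F (\sum_(i <- r) v i *t w i) = \sum_(i <- r) F (v i) (w i).
Proof.
move=> bF; rewrite (linear_bigsum _ _ (tsum_linear bF)).
by apply: eq_bigr => i _; rewrite tsumE.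
Qed.

Lemma lin_sum U X I (r : seq I) (F : I -> X -> U) :
  (forall i, linear (F i)) -> linear (fun x => \sum_(i <- r) F i x).
Proof.
move=> lF a x y; rewrite scaler_sumr -big_split.
by apply: eq_bigr => i _; apply: lF.
Qed.

Lemma lin_coord n (i : 'I_n) : linear (fun v : 'rV[k]_n => v 0 i : k^o).
Proof. by move=> a x y; rewrite !mxE. Qed.

Lemma lin_coordZ n (i : 'I_n) U (u : U) :
  linear (fun v : 'rV[k]_n => v 0 i *: u).
Proof. exact: lin_scalel (lin_coord i). Qed.

Lemma row_ext n U (f g : 'rV[k]_n -> U) : linear f -> linear g ->
  (forall i, f (delta_mx 0 i) = g (delta_mx 0 i)) -> f =1 g.
Proof.
move=> lf lg fg v; rewrite (row_sum_delta v) !linear_bigsum //.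
by apply: eq_bigr => i _; rewrite !(linear_scale _ lf, linear_scale _ lg) fg.
Qed.

Lemma sum_deltaZ n U (F : 'I_n -> U) i :
  \sum_j (i == j)%:R *: F j = F i :> U.
Proof.
rewrite (bigD1 i) //= eqxx scale1r big1 ?addr0 // => j ji.
by rewrite eq_sym (negPf ji) scale0r.
Qed.

Lemma delta_coord n (i j : 'I_n) :
  (delta_mx 0 i : 'rV[k]_n) 0 j = (i == j)%:R.
Proof. by rewrite mxE eqxx eq_sym. Qed.

Lemma sum_delta_coord n U (F : 'I_n -> U) i :
  \sum_j (delta_mx 0 i : 'rV[k]_n) 0 j *: F j = F i.
Proof. by under eq_bigr do rewrite delta_coord; exact: sum_deltaZ. Qed.

Definition rdot n (c v : 'rV[k]_n) : k^o := \sum_i c 0 i *: (v 0 i : k^o).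

Lemma rdot_bilin n : bilin (@rdot n).
Proof.
by split=> [v|c]; apply: lin_sum => i; [exact: lin_coordZ
  | apply: lin_scaler; exact: lin_coord].
Qed.

Lemma rdot_deltal n (i : 'I_n) v : rdot (delta_mx 0 i) v = v 0 i.
Proof. exact: sum_delta_coord. Qed.

Lemma rdot_deltar n (i : 'I_n) c : rdot c (delta_mx 0 i) = c 0 i.
Proof.
rewrite /rdot -[RHS](sum_deltaZ (fun j => c 0 j : k^o)).
apply: eq_bigr => j _; rewrite delta_coord.
by rewrite /GRing.scale /= mulrC.
Qed.

End LinearExtra.
#[local] Hint Resolve rdot_bilin : lindb.

(** * Finite-dimensional comodules and local finiteness *)

Section FreeComodules.
Variables (k : fieldType) (H : hopfAlg k).

(** Entry [i j] is the coefficient of the basis vector [i] in the coaction of the basis vector [j]: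
    the record is a comodule structure on row vectors, in a form that makes duals explicit. *)
Record comatrix n := Comatrix {
  cmx :> 'I_n -> 'I_n -> H;
  cmx_comul : forall i j, comul (cmx i j) = \sum_l cmx i l *t cmx l j;
  cmx_counit : forall i j, counit (cmx i j) = (i == j)%:R }.

Section Free.
Variables (n : nat) (T : comatrix n).

Definition fcoact_fun (v : 'rV[k]_n) : tens 'rV[k]_n H :=
  \sum_j v 0 j *: \sum_i delta_mx 0 i *t T i j.

Lemma fcoact_linear : linear fcoact_fun.
Proof. by apply: lin_sum => j; apply: lin_coordZ. Qed.

Definition fcoact := mklin fcoact_linear.

Lemma fcoact_delta j : fcoact (delta_mx 0 j) = \sum_i delta_mx 0 i *t T i j.
Proof. exact: sum_delta_coord. Qed.

Lemma fcoactA v :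
  \tsum_(m0, m1 <- fcoact v) \tsum_(a, b <- fcoact m0) a *t (b *t m1) =
  \tsum_(m0, m1 <- fcoact v) m0 *t comul m1.
Proof.
move: v; apply: row_ext; [linp|linp|] => j.
rewrite fcoact_delta !tsum_sum; [|linp|linp].
transitivity (\sum_i \sum_l (delta_mx 0 l : 'rV[k]_n) *t (T l i *t T i j)).
  by apply: eq_bigr => i _; rewrite fcoact_delta tsum_sum //; linp.
rewrite exchange_big; apply: eq_bigr => l _.
by rewrite cmx_comul ptens_sumr.
Qed.

Lemma fcoact_counit v : \tsum_(m0, m1 <- fcoact v) counit m1 *: m0 = v.
Proof.
move: v; apply: row_ext; [linp|linp|] => j.
rewrite fcoact_delta tsum_sum; last linp.
under eq_bigr do rewrite cmx_counit eq_sym.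
exact: sum_deltaZ.
Qed.

Definition fcomod : comod H := @Comod k H 'rV[k]_n fcoact fcoactA fcoact_counit.

Definition fbase (i : 'I_n) : fcomod := delta_mx 0 i.

Lemma coact_fbase j : coact (fbase j) = \sum_i fbase i *t T i j.
Proof. exact: fcoact_delta. Qed.

Lemma fcomod_ext (U : lmodType k) (f g : fcomod -> U) : linear f -> linear g ->
  (forall i, f (fbase i) = g (fbase i)) -> f =1 g.
Proof. exact: row_ext. Qed.

End Free.

Section Coefficients.
Variables (A : comod H) (n : nat) (v : 'I_n -> A) (t : 'I_n -> 'I_n -> H).
Hypothesis coact_v : forall j, coact (v j) = \sum_i v i *t t i j.

(** Applying [f i] to the comodule factor in coassociativity and in the counit law at [v j] isolates
    the coefficients. *)
Lemma coefficients_comatrix (f : 'I_n -> {scalar A}) :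
  (forall i j, f i (v j) = (i == j)%:R) -> exists T : comatrix n, T =2 t.
Proof.
move=> fv.
have tM i j : comul (t i j) = \sum_l t i l *t t l j.
  have := @coact_sw k H A _ (fun a b c => f i a *: (b *t c)) (v j).
  rewrite coact_v !tsum_sum; try by linp.
  move=> e; apply: etrans (etrans (esym (e _ _ _)) _); try by linp.
    rewrite -(sum_deltaZ (fun l => comul (t l j)) i); apply: eq_bigr => l _.
    by rewrite fv -[in LHS](tsum_ptens (comul (t l j))) tsum_comp //; linp.
  apply: eq_bigr => l _; rewrite coact_v tsum_sum; last linp.
  under eq_bigr do rewrite fv.
  exact: (sum_deltaZ (fun m => t m l *t t l j)).
have t1 i j : counit (t i j) = (i == j)%:R.
  rewrite -fv -[in RHS](coact_counit (v j)) coact_v tsum_sum; last linp.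
  rewrite linear_sum /=.
  under eq_bigr do rewrite linearZ_LR /= fv.
  rewrite (bigD1 i) //= eqxx mulr1 big1 ?addr0 // => l li.
  by rewrite eq_sym (negPf li) mulr0.
by exists (Comatrix tM t1).
Qed.

Definition fmap_fun (u : 'rV[k]_n) : A := \sum_i u 0 i *: v i.

Lemma fmap_linear : linear fmap_fun.
Proof. by apply: lin_sum => j; apply: lin_coordZ. Qed.

Variables (T : comatrix n) (Tt : T =2 t).

Lemma fmap_colinear : @colinear k H (fcomod T) A fmap_fun.
Proof.
have lf := fmap_linear.
apply: fcomod_ext; [linp|linp|] => j.
rewrite coact_fbase tsum_sum; last linp.
rewrite [fmap_fun _]sum_delta_coord coact_v; apply: eq_bigr => i _.
by rewrite [fmap_fun _]sum_delta_coord Tt.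
Qed.

Definition fmap : comod_hom (fcomod T) A :=
  mkchom (fmap_linear : @GRing.linear_for _ (fcomod T) _ _ _) fmap_colinear.

Lemma fmap_fbase i : fmap (fbase T i) = v i.
Proof. exact: sum_delta_coord. Qed.

End Coefficients.

(* By the last clause the image of q is the smallest subcomodule containing   *)
(* a, so every colinear map killing a kills this image.                       *)
Lemma comod_local_finiteness (A : comod H) (a : A) :
  exists n (T : comatrix n) (q : comod_hom (fcomod T) A) (u : fcomod T),
    q u = a /\ exists g : 'I_n -> {scalar H},
      forall i, q (fbase T i) = \tsum_(a0, a1 <- coact a) g i a1 *: a0.
Proof.
have [n [v [b [aE [f fv] [g gb]]]]] := tens_dual_decomposition (coact a).
(* Coassociativity at [a], with [g j] applied to the last factor, expands [coact (v j)] in the [v i]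
   with these coefficients. *)
pose t i j := \tsum_(x, y <- comul (b i)) g j y *: x.
have coact_v j : coact (v j) = \sum_i v i *t t i j.
  have := @coact_sw k H A _ (fun x y z => g j z *: (x *t y)) a.
  rewrite aE !tsum_sum; try by linp.
  move=> e; apply: etrans (etrans (e _ _ _) _); try by linp.
    rewrite -(sum_deltaZ (fun i => coact (v i)) j); apply: eq_bigr => i _.
    by rewrite gb -[in LHS](tsum_ptens (coact (v i))) tsum_comp //; linp.
  apply: eq_bigr => i _; rewrite /t.
  rewrite (tsum_comp (g := fun x => v i *t x)); last linp.
  apply: eq_tsum => x y.
  by rewrite (linear_scale _ ((bilin_ptens _ _).2 _)).
have [T Tt] := coefficients_comatrix coact_v fv.
(* The counit law writes [a] as the sum of the [counit (b i) *: v i]. *)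
exists n, T, (fmap coact_v Tt), (\row_i counit (b i)); split.
  rewrite -[RHS]coact_counit aE tsum_sum; last linp.
  by rewrite /= /fmap_fun; apply: eq_bigr => i _; rewrite mxE.
exists g => i; rewrite fmap_fbase aE tsum_sum; last linp.
by under [RHS]eq_bigr do rewrite gb; rewrite sum_deltaZ.
Qed.

Definition regular_comod : comod H :=
  @Comod k H H comul (@comulA k H) (@counitr k H).

(** * Direct sums of comodules *)

Section Product.
Variables A B : comod H.

Definition pinl (a : A) : (A * B)%type := (a, 0).
Definition pinr (b : B) : (A * B)%type := (0, b).

Lemma pinl_linear : linear pinl.
Proof. by move=> c x y; apply/pair_equal_spec; rewrite /= scaler0 addr0. Qed.
Lemma pinr_linear : linear pinr.
Proof. by move=> c x y; apply/pair_equal_spec; rewrite /= scaler0 addr0. Qed.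
Local Hint Resolve pinl_linear pinr_linear : lindb.

Lemma pfst_linear : linear (fun x : (A * B)%type => x.1). Proof. by []. Qed.
Lemma psnd_linear : linear (fun x : (A * B)%type => x.2). Proof. by []. Qed.

Lemma pair_decomp (x : (A * B)%type) : x = pinl x.1 + pinr x.2.
Proof. by case: x => a b; apply/pair_equal_spec; rewrite /= addr0 add0r. Qed.

Lemma prod_ext (U : lmodType k) (f g : (A * B)%type -> U) :
  linear f -> linear g -> (forall a, f (pinl a) = g (pinl a)) ->
  (forall b, f (pinr b) = g (pinr b)) -> f =1 g.
Proof.
by move=> lf lg fl fr x; rewrite (pair_decomp x) !linear_add // fl fr.
Qed.

Definition prod_coact_fun (x : (A * B)%type) : tens (A * B)%type H :=
  \tsum_(a0, a1 <- coact x.1) pinl a0 *t a1 +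
  \tsum_(b0, b1 <- coact x.2) pinr b0 *t b1.

Lemma prod_coact_linear : linear prod_coact_fun.
Proof.
apply: lin_add.
  by apply: (lin_fn (L := fun a => \tsum_(a0, a1 <- coact a) pinl a0 *t a1)
     (f := fun x : (A * B)%type => x.1)); [linp | exact: pfst_linear].
by apply: (lin_fn (L := fun a => \tsum_(a0, a1 <- coact a) pinr a0 *t a1)
   (f := fun x : (A * B)%type => x.2)); [linp | exact: psnd_linear].
Qed.

Definition prod_coact := mklin prod_coact_linear.

Lemma prod_coactl a : prod_coact (pinl a) =
  \tsum_(a0, a1 <- coact a) pinl a0 *t a1.
Proof.
rewrite /= /prod_coact_fun /= linear0 (linear_0 (tsum_linear _)) ?addr0 //.
linp.
Qed.

Lemma prod_coactr b : prod_coact (pinr b) =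
  \tsum_(a0, a1 <- coact b) pinr a0 *t a1.
Proof.
rewrite /= /prod_coact_fun /= linear0 (linear_0 (tsum_linear _)) ?add0r //.
linp.
Qed.

Lemma prod_coactA x :
  \tsum_(m0, m1 <- prod_coact x) \tsum_(a, b <- prod_coact m0) a *t (b *t m1) =
  \tsum_(m0, m1 <- prod_coact x) m0 *t comul m1.
Proof.
have aux (D : comod H) (i : D -> (A * B)%type) (li : linear i) d :
    (forall d, prod_coact (i d) = \tsum_(a0, a1 <- coact d) i a0 *t a1) ->
    \tsum_(m0, m1 <- prod_coact (i d)) \tsum_(a, b <- prod_coact m0)
      a *t (b *t m1) = \tsum_(m0, m1 <- prod_coact (i d)) m0 *t comul m1.
  move=> iE; rewrite iE !(tsum_comp _ _ (tsum_linear _)); [|linp|linp].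
  transitivity (\tsum_(m0, m1 <- coact d) \tsum_(a, b <- coact m0)
      i a *t (b *t m1)).
    apply: eq_tsum => m0 m1; rewrite tsumE; last linp.
    rewrite iE (tsum_comp _ _ (tsum_linear _)); last linp.
    by apply: eq_tsum => a b; rewrite tsumE //; linp.
  rewrite coact_sw; try by linp.
  apply: eq_tsum => m0 m1; rewrite tsumE; last linp.
  by rewrite -[in RHS](tsum_ptens (comul m1)) tsum_comp //; linp.
move: x; apply: prod_ext; [linp|linp|move=> a|move=> b]; apply: aux.
- exact: pinl_linear.
- exact: prod_coactl.
- exact: pinr_linear.
- exact: prod_coactr.
Qed.

Lemma prod_coact_counit x : \tsum_(m0, m1 <- prod_coact x) counit m1 *: m0 = x.
Proof.
move: x; apply: prod_ext; [linp|linp|move=> a|move=> a].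
  rewrite prod_coactl (tsum_comp _ _ (tsum_linear _)); last linp.
  rewrite -[in RHS](coact_counit a) (tsum_comp _ _ pinl_linear).
  apply: eq_tsum => m0 m1; rewrite tsumE; last linp.
  by rewrite (linear_scale _ pinl_linear).
rewrite prod_coactr (tsum_comp _ _ (tsum_linear _)); last linp.
rewrite -[in RHS](coact_counit a) (tsum_comp _ _ pinr_linear).
apply: eq_tsum => m0 m1; rewrite tsumE; last linp.
by rewrite (linear_scale _ pinr_linear).
Qed.

Definition prod_comod : comod H :=
  @Comod k H (A * B)%type prod_coact prod_coactA prod_coact_counit.

Lemma pfst_colinear : @colinear k H prod_comod A (fun x => x.1).
Proof.
have l1 := pfst_linear.
apply: prod_ext; [linp|linp|move=> a|move=> a].
  rewrite [coact (pinl a : prod_comod)]prod_coactl.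
  rewrite (tsum_comp _ _ (tsum_linear _)); last linp.
  rewrite -[in LHS](tsum_ptens (coact a)).
  by apply: eq_tsum => m0 m1; rewrite tsumE //; linp.
rewrite [coact (pinr a : prod_comod)]prod_coactr.
rewrite (tsum_comp _ _ (tsum_linear _)); last linp.
rewrite /= linear0; symmetry; apply: big1 => p _; rewrite tsumE; last linp.
exact: (linear_0 ((bilin_ptens _ _).1 _)).
Qed.

Lemma psnd_colinear : @colinear k H prod_comod B (fun x => x.2).
Proof.
have l1 := psnd_linear.
apply: prod_ext; [linp|linp|move=> a|move=> a]; last first.
  rewrite [coact (pinr a : prod_comod)]prod_coactr.
  rewrite (tsum_comp _ _ (tsum_linear _)); last linp.
  rewrite -[in LHS](tsum_ptens (coact a)).
  by apply: eq_tsum => m0 m1; rewrite tsumE //; linp.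
rewrite [coact (pinl a : prod_comod)]prod_coactl.
rewrite (tsum_comp _ _ (tsum_linear _)); last linp.
rewrite /= linear0; symmetry; apply: big1 => p _; rewrite tsumE; last linp.
exact: (linear_0 ((bilin_ptens _ _).1 _)).
Qed.

Definition pfst : comod_hom prod_comod A :=
  @mkchom k H prod_comod A _ pfst_linear pfst_colinear.
Definition psnd : comod_hom prod_comod B :=
  @mkchom k H prod_comod B _ psnd_linear psnd_colinear.

End Product.

(** Local finiteness at the pair [(a, b)] in the direct sum, followed by the projections. A single
    [u] above both elements allows them to be compared in one comodule. *)
Lemma common_free_cover (A B : comod H) (a : A) (b : B) :
  exists n (T : comatrix n) (p : comod_hom (fcomod T) A)
    (q : comod_hom (fcomod T) B) (u : fcomod T), p u = a /\ q u = b.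
Proof.
have [n [T [r [u [ru _]]]]] :=
  comod_local_finiteness ((a, b) : prod_comod A B).
exists n, T, (chom_cmp (pfst A B) r), (chom_cmp (psnd A B) r), u.
by rewrite /= ru.
Qed.

End FreeComodules.

(** * Left duals of finite-dimensional comodules, evaluation and currying *)

Section Duals.
Variables (k : fieldType) (H : hopfAlg k).

(** The product of the algebra [H (x) H], over which the matrix of coproducts of a comatrix is
    inverted. *)
Definition tmul (s t : tens H H) : tens H H :=
  \tsum_(a, b <- s) \tsum_(c, d <- t) (a * c) *t (b * d).

Lemma tmul_bilin : bilin tmul.
Proof. rewrite /tmul; linp. Qed.
Local Hint Resolve tmul_bilin : lindb.

Lemma tmulE a b c d : tmul (a *t b) (c *t d) = (a * c) *t (b * d).
Proof. by rewrite /tmul !tsumE //; linp. Qed.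

Lemma tmulA r s t : tmul r (tmul s t) = tmul (tmul r s) t.
Proof.
move: r; apply: tens_ext; [linp|linp|] => a b.
move: s; apply: tens_ext; [linp|linp|] => c d.
move: t; apply: tens_ext; [linp|linp|] => e f.
by rewrite !tmulE !mulrA.
Qed.

Lemma tmul1 t : tmul t (1 *t 1) = t.
Proof.
by move: t; apply: tens_ext; [linp|linp|] => a b; rewrite tmulE !mulr1.
Qed.

Lemma tmul1l t : tmul (1 *t 1) t = t.
Proof.
by move: t; apply: tens_ext; [linp|linp|] => a b; rewrite tmulE !mul1r.
Qed.

Section Dual.
Variables (n : nat) (T : comatrix H n).

Lemma comatrix_antipodel i j :
  \sum_l antipode (T i l) * T l j = (i == j)%:R *: 1.
Proof.
by rewrite -(cmx_counit T) -antipodel cmx_comul tsum_sum //; linp.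
Qed.

Lemma comatrix_antipoder i j :
  \sum_l T i l * antipode (T l j) = (i == j)%:R *: 1.
Proof.
by rewrite -(cmx_counit T) -antipoder cmx_comul tsum_sum //; linp.
Qed.

(* Both sides are the inverse of the matrix [comul (T i j)] over H (x) H. *)
Lemma comul_antipode_comatrix i j :
  comul (antipode (T i j)) = \sum_l antipode (T l j) *t antipode (T i l).
Proof.
pose P i j := comul (antipode (T i j)).
pose Q i j := comul (T i j).
pose R i j := \sum_l antipode (T l j) *t antipode (T i l).
have PQ m : \sum_l tmul (P i l) (Q l m) = (i == m)%:R *: (1 *t 1).
  rewrite -comul1 -linearZ_LR /= -comatrix_antipodel linear_sum /=.
  by apply: eq_bigr => l _; rewrite comulM.
have QR m : \sum_l tmul (Q m l) (R l j) = (j == m)%:R *: (1 *t 1).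
  (* The sum over [l] is cancelled first, in the second factor; it forces [r = p], and the antipode
     law then applies to the first factor. *)
  transitivity (\sum_p \sum_r (T m p * antipode (T r j)) *t
      \sum_l (T p l * antipode (T l r))).
    transitivity (\sum_l \sum_p \sum_r (T m p * antipode (T r j)) *t
        (T p l * antipode (T l r))).
      apply: eq_bigr => l _; rewrite /Q cmx_comul.
      rewrite (linear_bigsum _ _ (tmul_bilin.1 _)); apply: eq_bigr => p _.
      rewrite (linear_bigsum _ _ (tmul_bilin.2 _)); apply: eq_bigr => r _.
      exact: tmulE.
    rewrite exchange_big; apply: eq_bigr => p _.
    by rewrite exchange_big; apply: eq_bigr => r _; rewrite ptens_sumr.
  transitivity (\sum_p (T m p * antipode (T p j)) *t (1 : H)).
    apply: eq_bigr => p _.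
    under eq_bigr do rewrite comatrix_antipoder
      (linear_scale _ ((bilin_ptens _ _).2 _)).
    exact: (sum_deltaZ (fun r => (T m p * antipode (T r j)) *t (1 : H))).
  rewrite -ptens_suml comatrix_antipoder eq_sym.
  by rewrite (linear_scale _ ((bilin_ptens _ _).1 _)).
rewrite -/(P i j) -/(R i j).
transitivity (\sum_m tmul (P i m) (\sum_l tmul (Q m l) (R l j))).
  under eq_bigr do rewrite QR (linear_scale _ (tmul_bilin.2 _)) tmul1.
  by rewrite sum_deltaZ.
transitivity (\sum_l tmul (\sum_m tmul (P i m) (Q m l)) (R l j)).
  under eq_bigr do rewrite (linear_bigsum _ _ (tmul_bilin.2 _)).
  under [RHS]eq_bigr do rewrite (linear_bigsum _ _ (tmul_bilin.1 _)).
  rewrite exchange_big; apply: eq_bigr => l _; apply: eq_bigr => m _.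
  exact: tmulA.
under eq_bigr do rewrite PQ (linear_scale _ (tmul_bilin.1 _)) tmul1l.
by rewrite sum_deltaZ.
Qed.

Lemma counit_antipode_comatrix i j : counit (antipode (T i j)) = (i == j)%:R.
Proof.
have := congr1 counit (comatrix_antipodel i j).
rewrite linearZ_LR /= counit1 mulr1 => <-; rewrite linear_sum /=.
under eq_bigr do rewrite counitM cmx_counit.
rewrite (bigD1 j) //= eqxx mulr1 big1 ?addr0 // => l /negPf ->.
by rewrite mulr0.
Qed.

Lemma cdual_comul i j : comul (antipode (T j i)) =
  \sum_l antipode (T l i) *t antipode (T j l).
Proof. exact: comul_antipode_comatrix. Qed.

Lemma cdual_counit i j : counit (antipode (T j i)) = (i == j)%:R.
Proof. by rewrite eq_sym counit_antipode_comatrix. Qed.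

(** The entries, inferred from the two laws, are those of the transposed antipode of [T]; [ev]
    exhibits the comodule as a left dual of [fcomod T]. *)
Definition cdual : comatrix H n := Comatrix cdual_comul cdual_counit.

Definition ev_fun (t : ctens (fcomod cdual) (fcomod T)) : cunit H :=
  \tsum_(c, v <- t) rdot c v.

Lemma ev_funE c v : ev_fun (c *t v) = rdot c v.
Proof. by rewrite /ev_fun tsumE //; linp. Qed.

Lemma ev_linear : linear ev_fun.
Proof. by rewrite /ev_fun; linp. Qed.

Lemma ev_colinear : colinear ev_fun.
Proof.
have lev := ev_linear.
apply: (colinear_tens ev_linear) => c v; move: c.
apply: fcomod_ext; [linp|linp|] => i; move: v.
apply: fcomod_ext; [linp|linp|] => j.
rewrite ev_funE !coact_fbase tsum_sum; last linp.
rewrite coact_cunit rdot_deltar delta_coord.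
transitivity (\sum_l (1 : cunit H) *t (antipode (T i l) * T l j)).
  rewrite -ptens_sumr comatrix_antipodel ptensZ.
  by congr (_ *t _); rewrite /GRing.scale /= mulr1.
apply: eq_bigr => l _; rewrite tsum_sum; last linp.
rewrite -(sum_deltaZ (fun m => (1 : cunit H) *t (antipode (T i l) * T m j)) l).
apply: eq_bigr => m _; rewrite ev_funE rdot_deltar delta_coord.
rewrite -(linear_scale _ ((bilin_ptens _ _).1 _)).
by congr (_ *t _); rewrite /GRing.scale /= mulr1.
Qed.

Definition ev : comod_hom (ctens (fcomod cdual) (fcomod T)) (cunit H) :=
  mkchom ev_linear ev_colinear.

Definition fev (N : comod H) :
    comod_hom (ctens (ctens N (fcomod cdual)) (fcomod T)) N :=
  chom_cmp (crunit N) (chom_cmp (ctensm (chom_id N) ev) (cassoc _ _ _)).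

Lemma fevE (N : comod H) (x : N) c v : fev N ((x *t c) *t v) = rdot c v *: x.
Proof. by rewrite /= cassoc_funE ctensm_funE crunit_funE /= ev_funE. Qed.

Section Curry.
Variables (W N : comod H) (g : comod_hom (ctens W (fcomod T)) N).

(** Coevaluation followed by [g]. Colinearity rests on the antipode of [T] being a right inverse of
    [T], whereas that of [ev] rests on its being a left inverse. *)
Definition curry_fun (w : W) : ctens N (fcomod cdual) :=
  \sum_i g (w *t fbase T i) *t fbase cdual i.

Lemma curry_linear : linear curry_fun.
Proof. by apply: lin_sum => i; linp. Qed.

Lemma curry_colinear : colinear curry_fun.
Proof.
move=> w; rewrite linear_sum.
pose F w0 l m (x : H) := (g (w0 *t fbase T l) *t fbase cdual m :
  ctens N (fcomod cdual)) *t x.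
transitivity (\tsum_(w0, w1 <- coact w)
  \sum_l \sum_m \sum_i F w0 l m (w1 * (T l i * antipode (T i m)))).
  transitivity (\sum_i \tsum_(w0, w1 <- coact w)
    \sum_l \sum_m F w0 l m (w1 * (T l i * antipode (T i m)))).
    apply: eq_bigr => i _; rewrite coact_ctens.
    rewrite comod_hom_colinear coact_ctens.
    do 2 (rewrite (tsum_comp _ _ (tsum_linear _)); last linp).
    apply: eq_tsum => w0 w1; rewrite !coact_fbase.
    rewrite (tsum_comp _ _ (tsum_linear _)); last linp.
    rewrite tsum_sum; last linp.
    apply: eq_bigr => l _; do 2 (rewrite tsumE; last linp).
    rewrite tsum_sum; last linp.
    by apply: eq_bigr => m _; rewrite mulrA.
  rewrite /tsum exchange_big; apply: eq_bigr => p _.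
  by rewrite exchange_big; apply: eq_bigr => l _; rewrite exchange_big.
apply: eq_tsum => w0 w1; rewrite /curry_fun ptens_suml; apply: eq_bigr => l _.
rewrite -[RHS](sum_deltaZ (fun m => F w0 l m w1)); apply: eq_bigr => m _.
rewrite /F -ptens_sumr -mulr_sumr comatrix_antipoder -scalerAr mulr1.
exact: (linear_scale _ ((bilin_ptens _ _).2 _)).
Qed.

Definition curry : comod_hom W (ctens N (fcomod cdual)) :=
  mkchom curry_linear curry_colinear.

(** A triangle identity of the duality. It exhibits [g] as [fev N] precomposed with a map acting on
    the factor [W] only, a form to which naturality of [iota] applies. *)
Lemma fev_curry :
  g = chom_cmp (fev N) (ctensm curry (chom_id (fcomod T))).
Proof.
apply: comod_homP; apply: tens_ext; [linp|linp|] => w v.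
transitivity (fev N (curry w *t v)); last by rewrite [RHS]/= ctensm_funE.
rewrite [curry w]/(curry_fun w) ptens_suml.
rewrite (linear_bigsum _ _ (comod_hom_linear (fev N))).
rewrite [in LHS](row_sum_delta v) ptens_sumr.
rewrite (linear_bigsum _ _ (comod_hom_linear g)); apply: eq_bigr => i _.
rewrite fevE rdot_deltal (linear_scale _ ((bilin_ptens _ _).2 _)).
exact: (linear_scale _ (comod_hom_linear g)).
Qed.

End Curry.
End Dual.
End Duals.

(** * Elements of [H] as matrix coefficients *)

Section MatrixCoefficients.
Variables (k : fieldType) (H : hopfAlg k).

Definition coef n (T : comatrix H n) (c : fcomod (cdual T))
    (v : fcomod T) : H :=
  \tsum_(v0, v1 <- coact v) rdot c v0 *: v1.

Lemma coef_bilin n (T : comatrix H n) : bilin (@coef n T).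
Proof. rewrite /coef; linp. Qed.

Lemma coef_fbase n (T : comatrix H n) i j :
  coef (fbase (cdual T) i) (fbase T j) = T i j.
Proof.
rewrite /coef coact_fbase tsum_sum; last linp.
under eq_bigr do rewrite rdot_deltal delta_coord eq_sym.
exact: (sum_deltaZ (fun l => T l j)).
Qed.

Section Pull.
Variables (n : nat) (T : comatrix H n) (A : comod H).
Variables (q : comod_hom (fcomod T) A) (phi : A -> k^o) (lphi : linear phi).

(** The transpose of [q]: the row vector that represents the functional [phi] composed with [q]. *)
Definition pull : fcomod (cdual T) := \row_i phi (q (fbase T i)).

Lemma rdot_pull u : rdot pull u = phi (q u).
Proof.
move: u; apply: fcomod_ext; [linp|linp|] => i.
by rewrite rdot_deltar mxE.
Qed.

Lemma coef_pull u :
  coef pull u = \tsum_(a0, a1 <- coact (q u)) (phi a0 : k) *: a1.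
Proof.
rewrite comod_hom_colinear (tsum_comp _ _ (tsum_linear _)); last linp.
by apply: eq_tsum => x y; rewrite tsumE ?rdot_pull //; linp.
Qed.

End Pull.

(** In the regular comodule the coefficient of the counit at [h] is [h] itself, by the left counit
    law. *)
Lemma coef_regular n (T : comatrix H n)
    (q : comod_hom (fcomod T) (regular_comod H)) u :
  coef (pull q (counit : regular_comod H -> k^o)) u = q u.
Proof.
rewrite coef_pull; first exact: counitl.
by move=> a x y; rewrite linearP.
Qed.

(** With one vector [v] for both elements, linear combinations in [H] become linear combinations of
    functionals. The case [g = h] presents a single element. *)
Lemma common_coef (g h : H) : exists n (T : comatrix H n)
  (c d : fcomod (cdual T)) (v : fcomod T), coef c v = g /\ coef d v = h.
Proof.
have [n [T [p [q [u [pu qu]]]]]] :=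
  common_free_cover (g : regular_comod H) (h : regular_comod H).
by exists n, T, (pull p (counit : regular_comod H -> k^o)),
  (pull q (counit : regular_comod H -> k^o)), u; rewrite !coef_regular.
Qed.

End MatrixCoefficients.
#[local] Hint Resolve coef_bilin : lindb.

(** * The action recovered from a natural family [io] *)

Section InducedAction.
Variables (k : fieldType) (H : hopfAlg k) (M : comod H).
Variable io : forall W V : comod H,
  comod_hom (ctens W V) M -> comod_hom (ctens V W) M.
Hypothesis io_nat : forall (W W' V V' : comod H) (f : comod_hom W W')
    (g : comod_hom V V') (x : comod_hom (ctens W' V') M),
  io (chom_cmp x (ctensm f g)) = chom_cmp (io x) (ctensm g f).

Lemma io_natE (W W' V V' : comod H) (f : comod_hom W W') (g : comod_hom V V')
    (x : comod_hom (ctens W' V') M) v w :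
  io (chom_cmp x (ctensm f g)) (v *t w) = io x (g v *t f w).
Proof. by rewrite io_nat /= ctensm_funE. Qed.

(** The intended value of [coef c v] acting on [m]; a priori it depends on [T], [c] and [v]. *)
Definition preact n (T : comatrix H n) (c : fcomod (cdual T)) (v : fcomod T)
    (m : M) : M := io (fev T M) (v *t (m *t c)).

Lemma io_curry n (T : comatrix H n) W
    (g : comod_hom (ctens W (fcomod T)) M) v w :
  io g (v *t w) = io (fev T M) (v *t curry g w).
Proof. by rewrite [in LHS](fev_curry g) io_natE. Qed.

Lemma io_free n (T : comatrix H n) W
    (g : comod_hom (ctens W (fcomod T)) M) v w :
  io g (v *t w) =
  \sum_i preact (fbase (cdual T) i) v (g (w *t fbase T i)).
Proof.
rewrite io_curry [curry g w]/(curry_fun g w) ptens_sumr.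
by rewrite (linear_bigsum _ _ (comod_hom_linear _)).
Qed.

(** Naturality in the second factor along [q], then currying over [U], which transposes the
    functional. *)
Lemma preact_pull n (T : comatrix H n) n' (U : comatrix H n')
    (q : comod_hom (fcomod U) (fcomod T)) (c : fcomod (cdual T)) u m :
  preact c (q u) m = preact (pull q (rdot c)) u m.
Proof.
rewrite /preact -(io_natE (chom_id _)) io_curry /=; congr (io _ (_ *t _)).
rewrite /curry_fun (row_sum_delta (pull q (rdot c))) ptens_sumr.
apply: eq_bigr => i _ /=.
by rewrite ctensm_funE -[crunit_fun _]/(fev T M _) fevE mxE ptensZ.
Qed.

(** A cover [q] of the subcomodule generated by [v] has basis images obtained by applying
    functionals [g i] to the [H] factor of [coact v]. Hence [c] takes the value [g i (coef c v) = 0]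
    on them, and its pullback is zero. *)
Lemma preact_eq0 n (T : comatrix H n) (c : fcomod (cdual T)) v m :
  coef c v = 0 -> preact c v m = 0.
Proof.
move=> cv0; have [n' [U [q [u [qu [g gE]]]]]] := comod_local_finiteness v.
rewrite -qu preact_pull; have -> : pull q (rdot c) = 0.
  apply/rowP => i; rewrite !mxE gE tsum_comp; last linp.
  transitivity (g i (coef c v)); last by rewrite cv0 linear0.
  rewrite /coef /tsum linear_sum /=; apply: eq_bigr => p _.
  rewrite (linear_scale _ ((rdot_bilin _ _).2 _)) linearZ_LR /=.
  exact: mulrC.
rewrite /preact (linear_0 ((bilin_ptens _ _).2 _)).
by rewrite (linear_0 ((bilin_ptens _ _).2 _)) (linear_0 (comod_hom_linear _)).
Qed.

Lemma preact_linearl n (T : comatrix H n) (v : fcomod T) m :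
  linear (fun c : fcomod (cdual T) => preact c v m).
Proof. rewrite /preact; linp. Qed.

Lemma preact_linearr n (T : comatrix H n) (c : fcomod (cdual T)) v :
  linear (preact c v).
Proof. rewrite /preact; linp. Qed.

(** On a common cover of [v] and [v'] both functionals are pulled back to the same comodule, where
    their difference has coefficient zero at [u]. *)
Lemma preact_coef n (T : comatrix H n) (c : fcomod (cdual T)) v
    n' (T' : comatrix H n') (c' : fcomod (cdual T')) v' m :
  coef c v = coef c' v' -> preact c v m = preact c' v' m.
Proof.
have [l [U [p [q [u [<- <-]]]]]] := common_free_cover v v' => e.
rewrite !preact_pull.
have d0 : coef (-1 *: pull q (rdot c') + pull p (rdot c)) u = 0.
  rewrite (coef_bilin U).1 scaleN1r !coef_pull; try exact: (rdot_bilin _ _).2.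
  by rewrite -/(coef c (p u)) e addNr.
have := preact_eq0 m d0; rewrite preact_linearl scaleN1r addrC => /eqP.
by rewrite subr_eq0 => /eqP.
Qed.

Lemma io_action_exists : exists a : H -> M -> M,
  forall n (T : comatrix H n) (c : fcomod (cdual T)) v m,
    preact c v m = a (coef c v) m.
Proof.
suff /choice[a aP] : forall h, exists b : M -> M,
    forall n (T : comatrix H n) (c : fcomod (cdual T)) v m,
    coef c v = h -> preact c v m = b m.
  by exists a => n T c v m; apply: aP.
move=> h; have [n [T [c [_ [v [cv _]]]]]] := common_coef h h.
exists (preact c v) => n' T' c' v' m e.
by apply: preact_coef; rewrite e cv.
Qed.

Definition io_act : H -> M -> M := projT1 (cid io_action_exists).

Lemma preactE n (T : comatrix H n) (c : fcomod (cdual T)) v m :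
  preact c v m = io_act (coef c v) m.
Proof. exact: (projT2 (cid io_action_exists)). Qed.

Lemma io_act_bilin : bilin io_act.
Proof.
split=> [m a g h|h].
  have [n [T [c [d [v [<- <-]]]]]] := common_coef g h.
  by rewrite -(coef_bilin T).1 -!preactE preact_linearl.
have [n [T [c [_ [v [<- _]]]]]] := common_coef h h.
by move=> a x y; rewrite -!preactE preact_linearr.
Qed.
Local Hint Resolve io_act_bilin : lindb.

(** Naturality along a finite-dimensional cover of [v] reduces to [fcomod T], and linearity to a
    basis vector [j]; the elements acting in [io_free] are then the [T i j], which are the
    coefficients of its coaction. *)
Lemma ioE (W V : comod H) (g : comod_hom (ctens W V) M) v w :
  io g (v *t w) = \tsum_(v0, v1 <- coact v) io_act v1 (g (w *t v0)).
Proof.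
have [n [T [q [u [<- _]]]]] := comod_local_finiteness v.
rewrite -(io_natE (chom_id _)) comod_hom_colinear.
rewrite (tsum_comp _ _ (tsum_linear _)); last linp.
move: u; apply: fcomod_ext; [linp|linp|] => j.
rewrite io_free coact_fbase tsum_sum; last linp.
apply: eq_bigr => i _; rewrite tsumE; last linp.
by rewrite preactE coef_fbase /= ctensm_funE.
Qed.

Hypothesis io_unit : forall (W : comod H) (x : comod_hom W M),
  io (chom_cmp x (crunit W)) = chom_cmp x (clunit W).

Lemma io_act1 m : io_act 1 m = m.
Proof.
have /(congr1 (fun f : comod_hom (ctens (cunit H) M) M =>
  f ((1 : cunit H) *t m))) := io_unit (chom_id M).
rewrite ioE coact_cunit tsumE; last linp.
by rewrite /= crunit_funE clunit_funE !scale1r.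
Qed.

Hypothesis io_tensor : forall (W U V : comod H)
    (x : comod_hom (ctens W (ctens U V)) M),
  io x = chom_cmp (io (chom_cmp (io (chom_cmp x (cassoc W U V)))
    (cassoc V W U))) (cassoc U V W).

(** A nested evaluation [x] is sent through [io] in two ways: by [ioE] directly, where the coaction
    of [U (x) V] multiplies the coefficients, and by [io_tensor], where the two actions are applied
    in turn. *)
Lemma io_actM g h m : io_act (g * h) m = io_act g (io_act h m).
Proof.
have [n [T [c [_ [v [cv _]]]]]] := common_coef h h.
have [n' [U [d [_ [u [du _]]]]]] := common_coef g g.
pose w : ctens (ctens M (fcomod (cdual T))) (fcomod (cdual U)) :=
  (m *t c) *t d.
have [x xE] : exists x : comod_hom (ctens _ (ctens (fcomod U) (fcomod T))) M,
    forall u' v', x (w *t (u' *t v')) = (rdot d u' * rdot c v') *: m.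
  exists (chom_cmp (fev T M) (chom_cmp
    (ctensm (fev U (ctens M (fcomod (cdual T)))) (chom_id (fcomod T)))
    (cassocV _ _ _))) => u' v'.
  transitivity (fev T M (fev U (ctens M _) (w *t u') *t v')).
    by rewrite /= cassocV_funE ctensm_funE.
  rewrite fevE (linear_scale _ ((bilin_ptens _ _).1 _)).
  rewrite (linear_scale _ (comod_hom_linear (fev T M))).
  by rewrite fevE scalerA.
transitivity (io x ((u *t v) *t w)).
  rewrite ioE coact_ctens (tsum_comp _ _ (tsum_linear _)); last linp.
  rewrite -du -cv /coef (tsum_comp (g := fun y => io_act (y * _) m)); last linp.
  apply: eq_tsum => u0 u1; rewrite (tsum_comp _ _ (tsum_linear _)); last linp.
  rewrite (tsum_comp (g := fun y => io_act (_ * y) m)); last linp.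
  apply: eq_tsum => v0 v1; rewrite tsumE; last linp.
  rewrite xE (linear_scale _ (io_act_bilin.2 _)) -scalerAl -scalerAr scalerA.
  by rewrite (linear_scale _ (io_act_bilin.1 _)).
rewrite io_tensor /= cassoc_funE ioE.
rewrite -du -cv /coef (tsum_comp (g := fun y => io_act y _)); last linp.
apply: eq_tsum => u0 u1; rewrite [chom_cmp _ _ _]/= cassoc_funE ioE.
rewrite (linear_scale _ (io_act_bilin.1 _)).
rewrite -(linear_scale _ (io_act_bilin.2 _)); congr (io_act _ _).
rewrite (tsum_comp (g := fun y => io_act y _)); last linp.
rewrite (tsum_comp (g := fun y => _ *: y)); last linp.
apply: eq_tsum => v0 v1; rewrite [chom_cmp _ _ _]/= cassoc_funE xE.
rewrite (linear_scale _ (io_act_bilin.2 _)) (linear_scale _ (io_act_bilin.1 _)).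
by rewrite scalerA.
Qed.

(** This is colinearity of [io (fev T M)] at [v (x) (m (x) c)]. On basis vectors [v] contributes
    [h3] and the dual vector [c] contributes the antipode of [h1], on either side of [m1]. *)
Lemma io_act_compat h m : coact (io_act h m) =
  \tsum_(h1, h' <- comul h) \tsum_(h2, h3 <- comul h')
    \tsum_(m0, m1 <- coact m) io_act h2 m0 *t (h3 * m1 * antipode h1).
Proof.
have [n [T [c [_ [v [<- _]]]]]] := common_coef h h.
move: c; apply: fcomod_ext; [linp|linp|] => i.
move: v; apply: fcomod_ext; [linp|linp|] => j.
pose F p l m0 m1 := io_act (T p l) m0 *t (T l j * m1 * antipode (T i p)).
transitivity (\sum_l \sum_p \tsum_(m0, m1 <- coact m) F p l m0 m1).
  rewrite -preactE comod_hom_colinear coact_ctens coact_fbase.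
  rewrite tsum_sum; last linp.
  rewrite (linear_bigsum _ _ (tsum_linear _)); last linp.
  apply: eq_bigr => l _; rewrite coact_ctens coact_fbase.
  do 2 (rewrite (tsum_comp _ _ (tsum_linear _)); last linp).
  transitivity (\tsum_(m0, m1 <- coact m) \sum_p F p l m0 m1); last first.
    by rewrite /tsum exchange_big.
  apply: eq_tsum => m0 m1.
  do 2 (rewrite (tsum_comp _ _ (tsum_linear _)); last linp).
  rewrite tsum_sum; last linp.
  apply: eq_bigr => p _; do 2 (rewrite tsumE; last linp).
  by rewrite -/(preact _ _ _) preactE coef_fbase /F mulrA.
rewrite coef_fbase cmx_comul tsum_sum; last linp.
rewrite exchange_big; apply: eq_bigr => p _.
by rewrite cmx_comul tsum_sum //; linp.
Qed.

Hypothesis io_sym : forall (W : comod H) (x : comod_hom W M),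
  io (chom_cmp x (clunit W)) = chom_cmp x (crunit W).

Definition io_ayd : ayd H :=
  @AYD k H M io_act io_act_bilin io_act1 io_actM io_act_compat.

(** The symmetry axiom at the identity of [M], evaluated at [m (x) 1]. *)
Lemma io_ayd_stable : ayd_stable io_ayd.
Proof.
move=> m.
have /(congr1 (fun f : comod_hom (ctens M (cunit H)) M =>
  f (m *t (1 : cunit H)))) := io_sym (chom_id M).
rewrite ioE /= crunit_funE scale1r => e; rewrite -[RHS]e.
by apply: eq_tsum => m0 m1; rewrite clunit_funE scale1r.
Qed.

Lemma io_hom_iota (W V : comod H) (g : comod_hom (ctens W V) M) :
  hom_iota io_ayd W V g = io g.
Proof.
apply: comod_homP; apply: tens_ext; [linp|linp|] => v w.
by rewrite hom_iotaE ioE.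
Qed.

End InducedAction.

(** The quasi-inverse picks preimages of objects and lifts each morphism after conjugation by the
    chosen isomorphisms [e]. Its laws are checked after applying [F], which is faithful. *)
Lemma fully_faithful_eso_equivalence (C D : category) (F : functor C D) :
  (forall A B, injective (@fmor C D F A B)) ->
  (forall A B (g : hom (F A) (F B)), exists f, fmor F f = g) ->
  (forall Y : D, exists (X : C) (f : hom (F X) Y), is_iso f) ->
  is_equivalence F.
Proof.
move=> Finj Ffull Feso.
pose G0 Y := projT1 (cid (Feso Y)).
pose e Y : hom (F (G0 Y)) Y := projT1 (cid (projT2 (cid (Feso Y)))).
have eP Y : is_iso (e Y) := projT2 (cid (projT2 (cid (Feso Y)))).
pose e' Y : hom Y (F (G0 Y)) := projT1 (cid (eP Y)).
have e'e Y : cmp (e' Y) (e Y) = idm _ := (projT2 (cid (eP Y))).1.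
have ee' Y : cmp (e Y) (e' Y) = idm _ := (projT2 (cid (eP Y))).2.
pose lft A B (g : hom (F A) (F B)) : hom A B := projT1 (cid (Ffull A B g)).
have lftK A B (g : hom (F A) (F B)) : fmor F (lft A B g) = g :=
  projT2 (cid (Ffull A B g)).
pose Gm Y Z (g : hom Y Z) : hom (G0 Y) (G0 Z) :=
  lft _ _ (cmp (e' Z) (cmp g (e Y))).
have Gm1 Y : Gm Y Y (idm Y) = idm (G0 Y).
  by apply: Finj; rewrite lftK cmp1m e'e fmor1.
have GmM X Y Z (g : hom Y Z) (f : hom X Y) :
    Gm X Z (cmp g f) = cmp (Gm Y Z g) (Gm X Y f).
  apply: Finj; rewrite fmorM !lftK -!cmpA; congr (cmp _ (cmp _ _)).
  by rewrite cmpA ee' cmp1m.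
exists (@Functor D C G0 Gm Gm1 GmM); split.
  exists (fun A => lft _ _ (e (F A))); split=> [A|A B f] /=.
    exists (lft _ _ (e' (F A))); split; apply: Finj; rewrite fmorM !lftK fmor1.
      exact: e'e.
    exact: ee'.
  by apply: Finj; rewrite !fmorM !lftK cmpA ee' cmp1m.
exists e; split=> [//|Y Z g] /=.
by rewrite lftK cmpA ee' cmp1m.
Qed.

(** * The Hom functor is fully faithful and essentially surjective *)

Section Equivalence.
Variables (k : fieldType) (H : hopfAlg k).

Lemma hom_contratrace_faithful (M N : sayd_cat H) :
  injective (@fmor _ _ (hom_contratrace_functor H) M N).
Proof.
move=> f g fg; apply: ayd_homP => m.
have e := congr1 (fun t : ct_hom (hom_contratrace (svalP M))
    (hom_contratrace (svalP N)) =>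
  (t (ayd_comod (sval M)) (chom_id (sval M)) : comod_hom _ _) m) fg.
exact: e.
Qed.

(* Every h m is a value of iota on some evaluation map. *)
Lemma ayd_linear_of_iota (M N : ayd H) (g : comod_hom M N) :
  (forall (W V : comod H) (x : comod_hom (ctens W V) M),
    chom_cmp g (hom_iota M W V x) = hom_iota N W V (chom_cmp g x)) ->
  forall h m, g (act h m) = act h (g m).
Proof.
move=> gP h m.
have [n [T [c [_ [v [<- _]]]]]] := common_coef h h.
have aE (P : ayd H) (f : comod_hom M P) :
    hom_iota P _ _ (chom_cmp f (fev T M)) (v *t (m *t c)) =
    act (coef c v) (f m).
  rewrite hom_iotaE /coef (tsum_comp (g := fun y => act y _)); last linp.
  apply: eq_tsum => v0 v1.
  rewrite -[chom_cmp _ _ _]/(f (fev T M _)) fevE.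
  rewrite (linear_scale _ (comod_hom_linear f)).
  rewrite (linear_scale _ ((act_bilin P).2 _)).
  by rewrite (linear_scale _ ((act_bilin P).1 _)).
by rewrite -aE -gP -[in LHS](aE M (chom_id M)) chom_cmp1m.
Qed.

Lemma hom_contratrace_full (M N : sayd_cat H)
    (t : hom (hom_contratrace_functor H M) (hom_contratrace_functor H N)) :
  exists f, fmor (hom_contratrace_functor H) f = t.
Proof.
pose tau : forall A : comod H, comod_hom A (sval M) -> comod_hom A (sval N) :=
  ct_mor t.
pose g : comod_hom (sval M) (sval N) :=
  tau (ayd_comod (sval M)) (chom_id (sval M)).
(* Yoneda: naturality along [x], applied to the identity of [M]. *)
have tE (A : comod H) (x : comod_hom A (sval M)) : tau A x = chom_cmp g x.
  rewrite -[in LHS](chom_cmp1m x).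
  exact: (ct_mor_nat t x (chom_id (sval M))).
have gP h m : g (act h m) = act h (g m).
  apply: ayd_linear_of_iota => W V x; rewrite -!tE.
  exact: (ct_mor_iota t x).
exists (AYDHom gP : @hom (sayd_cat H) M N).
by apply: ct_homP => A x; symmetry; apply: tE.
Qed.

(** The representation [phi] transports [iota] to the spaces of maps into [M], where it induces a
    stable anti-Yetter-Drinfeld structure. By [io_hom_iota] the contratrace of this structure is the
    transported one, so [phi] itself is the isomorphism. *)
Lemma hom_contratrace_eso (Y : rep_sym_contratrace_cat (comod_monoidal H)) :
  exists (M : sayd_cat H) (f : hom (hom_contratrace_functor H M) Y), is_iso f.
Proof.
case: Y => F [M [phi [phi_bij phi_nat]]].
have psiP (A : comod H) : exists p : F A -> comod_hom A M,
    cancel (phi A) p /\ cancel p (phi A).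
  by have [p ? ?] := phi_bij A; exists p.
pose psi A := projT1 (cid (psiP A)).
have phiK A : cancel (phi A) (psi A) := (projT2 (cid (psiP A))).1.
have psiK A : cancel (psi A) (phi A) := (projT2 (cid (psiP A))).2.
have psi_nat (A B : comod H) (f : comod_hom A B) (x : F B) :
    psi A (pmor F (f : @khom k (comod_monoidal H) A B) x) =
    chom_cmp (psi B x) f.
  by apply: (can_inj (phiK A)); rewrite psiK [RHS]phi_nat psiK.
pose io (W V : comod H) (g : comod_hom (ctens W V) M) :
    comod_hom (ctens V W) M :=
  psi (ctens V W) (iota F W V (phi (ctens W V) g)).
have io_nat (W W' V V' : comod H) (f : comod_hom W W') (g : comod_hom V V')
    (x : comod_hom (ctens W' V') M) :
    io _ _ (chom_cmp x (ctensm f g)) = chom_cmp (io _ _ x) (ctensm g f).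
  rewrite /io -psi_nat phi_nat; congr (psi _ _).
  exact: (@iota_nat k (comod_monoidal H) F W W' V V' f g).
have io_unit (W : comod H) (x : comod_hom W M) :
    io _ _ (chom_cmp x (crunit W)) = chom_cmp x (clunit W).
  rewrite /io phi_nat [iota F _ _ _]iota_unit psi_nat; congr chom_cmp.
  exact: phiK.
have io_tensor (W U V : comod H) (x : comod_hom (ctens W (ctens U V)) M) :
    io _ _ x = chom_cmp (io _ _ (chom_cmp (io _ _ (chom_cmp x (cassoc W U V)))
      (cassoc V W U))) (cassoc U V W).
  by rewrite /io [iota F _ _ _]iota_tensor psi_nat !phi_nat psiK.
have io_sym (W : comod H) (x : comod_hom W M) :
    io _ _ (chom_cmp x (clunit W)) = chom_cmp x (crunit W).
  rewrite /io phi_nat [iota F _ _ _]iota_sym psi_nat; congr chom_cmp.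
  exact: phiK.
pose N := io_ayd io_nat io_unit io_tensor.
have sN : ayd_stable N := io_ayd_stable io_sym.
pose X : sayd_cat H := exist _ N sN.
have ioN (W V : comod H) (x : comod_hom (ctens W V) M) :
    hom_iota N W V x = psi (ctens V W) (iota F W V (phi (ctens W V) x)).
  exact: io_hom_iota.
have @Phi : ct_hom (hom_contratrace (svalP X)) F.
  apply: (@CtHom k (comod_monoidal H) (hom_contratrace (svalP X)) F
    (fun A x => phi A x)) => [A a x y|A B f x|W V x].
  - exact: linearP.
  - exact: phi_nat.
  - by rewrite [iota _ _ _ _]ioN psiK.
have @Psi : ct_hom F (hom_contratrace (svalP X)).
  apply: (@CtHom k (comod_monoidal H) F (hom_contratrace (svalP X)) psi)
    => [A a x y|A B f x|W V x].
  - by apply: (can_inj (phiK A)); rewrite linearP !psiK.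
  - exact: psi_nat.
  - by rewrite [RHS]ioN psiK.
exists X, Phi, Psi; split; apply: ct_homP => A x.
  exact: phiK.
exact: psiK.
Qed.

End Equivalence.

Theorem corollary2p9 (k : fieldType) (char_k : [pchar k]%R =i pred0)
    (H : hopfAlg k) (antipode_inv : bijective (@antipode k H)) :
  is_equivalence (hom_contratrace_functor H).
Proof.
apply: fully_faithful_eso_equivalence.
- exact: hom_contratrace_faithful.
- exact: hom_contratrace_full.
- exact: hom_contratrace_eso.
Qed.
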